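(* Let $X:\Sigma\to\mathbb{S}^2\times\mathbb{R}$ be a minimal conformal immersion and let $g$ be its Gauss map. If $g$ is a singular map, then $X(\Sigma)$ is part of a vertical cylinder over a geodesic of $\mathbb{S}^2$ in $\mathbb{S}^2\times\mathbb{R}$. In particular, $g$ is constant.
   Context: Model: $\mathbb{S}^2\times\mathbb{R}$ (with $\mathbb{S}^2$ the unit sphere and the product metric) is identified with $\mathbb{R}^3\setminus\{0\}$ with the metric $d\mu^2=|x|^{-2}(dx_1^2+dx_2^2+dx_3^2)$ through the isometry $(y,t)\mapsto e^t y$. A vertical cylinder over a geodesic of $\mathbb{S}^2$ is $\gamma\times\mathbb{R}$ with $\gamma$ a great circle of $\mathbb{S}^2$; in the model it is a plane through the origin of $\mathbb{R}^3$ (with the origin removed). ''Is part of'' means ''is contained in''. $\Sigma$ is a connected oriented Riemannian surface, with orientation-compatible local conformal coordinates $z=u+iv$; minimal means zero mean curvature with respect to $d\mu^2$. Gauss map: $E_j(x)=|x|\partial_{x_j}$, $j=1,2,3$, is a global orthonormal frame. Let $N=N_1E_1+N_2E_2+N_3E_3$ be the unit normal of $X$ in the direction of $X_u\times X_v$. The Gauss map of $X$ is $$g=\frac{N_1+iN_2}{1+N_3}:\Sigma\to\bar{\mathbb{C}}=\mathbb{C}\cup\{\infty\},$$ i.e. $N\in\mathbb{S}^2\subset\mathbb{R}^3$ composed with stereographic projection from the south pole. The map $g$ is singular if its differential is non-invertible at every point of $\Sigma$ (i.e. $|g_z|=|\bar g_z|$ everywhere, where $g\neq\infty$ and $\bar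 g_z=(\bar g)_z$). *)

(* Defs.v *)
From HB Require Import structures.
From mathcomp Require Import all_boot all_order all_algebra.
From mathcomp Require Import all_classical all_reals all_analysis.
From mathcomp Require Import complex.

Set Implicit Arguments.
Unset Strict Implicit.
Unset Printing Implicit Defensive.
Import Order.TTheory GRing.Theory Num.Theory.
Import numFieldNormedType.Exports.
Local Open Scope classical_set_scope.
Local Open Scope ring_scope.

(** * Smooth maps *)

(* [Ck n U f]: f is of class C^n on U. Meant for open U, so that the values of
   f outside U do not matter. *)
Fixpoint Ck (R : realType) (V W : normedModType R) (n : nat) (U : set V)
    (f : V -> W) : Prop :=
  if n is m.+1 then
    (forall x, U x -> differentiable f x) /\ (forall v, Ck m U ('D_v f))
  else forall x, U x -> {for x, continuous f}.

Definition smooth_on (R : realType) (V W : normedModType R) (U : set V)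
    (f : V -> W) : Prop :=
  forall n, Ck n U f.

(** * Oriented Riemannian surfaces *)

(* [cmap] is only relevant on [cdom], and [cinv] only on the image of [cdom]. *)
Record chart (R : realType) (S : topologicalType) := Chart {
  cdom : set S;
  cmap : S -> 'rV[R]_2;
  cinv : 'rV[R]_2 -> S }.

Definition cimg (R : realType) (S : topologicalType) (c : chart R S) :
    set 'rV[R]_2 :=
  cmap c @` cdom c.

Definition is_chart (R : realType) (S : topologicalType) (c : chart R S) :
    Prop :=
  [/\ open (cdom c), open (cimg c),
      (forall p, cdom c p -> cinv c (cmap c p) = p),
      (forall p, cdom c p -> {for p, continuous (cmap c)}) &
      (forall z, cimg c z -> {for z, continuous (cinv c)})].

Definition transition (R : realType) (S : topologicalType) (c d : chart R S) :
    'rV[R]_2 -> 'rV[R]_2 :=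
  cmap d \o cinv c.

(* Surfaces are given by an oriented smooth atlas (not necessarily maximal);
   [smetric c z] is the Gram matrix of the metric in the chart c at the point
   of coordinates z. Jacobian matrices act on row vectors from the right, hence
   the shape of the change-of-coordinates formula. *)
Record oriented_riemannian_surface (R : realType) (S : topologicalType) :=
  OrientedRiemannianSurface {
  atlas : set (chart R S);
  smetric : chart R S -> 'rV[R]_2 -> 'M[R]_2;
  surface_hausdorff : hausdorff_space S;
  surface_second_countable : @second_countable S;
  atlas_chart : forall c, atlas c -> is_chart c;
  atlas_cover : forall p, exists2 c, atlas c & cdom c p;
  atlas_smooth : forall c d, atlas c -> atlas d ->
    smooth_on (cmap c @` (cdom c `&` cdom d)) (transition c d);
  atlas_oriented : forall c d p, atlas c -> atlas d -> cdom c p -> cdom d p ->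
    0 < \det (jacobian (transition c d) (cmap c p));
  smetric_smooth : forall c, atlas c -> smooth_on (cimg c) (smetric c);
  smetric_sym : forall c z, atlas c -> cimg c z ->
    (smetric c z)^T = smetric c z;
  smetric_pos : forall c z (v : 'rV[R]_2), atlas c -> cimg c z -> v != 0 ->
    0 < (v *m smetric c z *m v^T) 0 0;
  smetric_change : forall c d p, atlas c -> atlas d -> cdom c p -> cdom d p ->
    let J := jacobian (transition c d) (cmap c p) in
    smetric c (cmap c p) = J *m smetric d (cmap d p) *m J^T }.

(** * The ambient space S^2 x R and its model R^3 \ {0} *)

(* The library norm on row vectors is the sup norm, hence these definitions. *)
Definition dot (R : realType) (n : nat) (u v : 'rV[R]_n) : R :=
  (u *m v^T) 0 0.

Definition enorm (R : realType) (n : nat) (u : 'rV[R]_n) : R :=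
  Num.sqrt (dot u u).

Definition sphere2 (R : realType) : Type := {y : 'rV[R]_3 | dot y y = 1}.

Definition S2xR (R : realType) : Type := (sphere2 R * R)%type.

Definition to_model {R : realType} (q : S2xR R) : 'rV[R]_3 :=
  expR q.2 *: sval q.1.

Definition great_circle {R : realType} (gamma : set (sphere2 R)) : Prop :=
  exists2 a : 'rV[R]_3, a != 0 & gamma = [set y | dot a (sval y) = 0].

Definition vertical_cylinder {R : realType} (gamma : set (sphere2 R)) :
    set (S2xR R) :=
  [set q | gamma q.1].

(* Gram matrix at x of d mu^2 = |x|^-2 (dx_1^2 + dx_2^2 + dx_3^2). *)
Definition mu2 (R : realType) (x : 'rV[R]_3) : 'M[R]_3 :=
  ((enorm x) ^- 2)%:M.

Definition mu2dot (R : realType) (x u v : 'rV[R]_3) : R :=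
  (u *m mu2 x *m v^T) 0 0.

Definition evec (R : realType) (n : nat) (i : 'I_n) : 'rV[R]_n := delta_mx 0 i.

(* Christoffel symbol Gamma^k_ij of d mu^2 *)
Definition christoffel (R : realType) (x : 'rV[R]_3) (k i j : 'I_3) : R :=
  2^-1 * \sum_(l < 3) invmx (mu2 x) k l *
    ('D_(evec R i) (fun y => mu2 y j l) x
     + 'D_(evec R j) (fun y => mu2 y i l) x
     - 'D_(evec R l) (fun y => mu2 y i j) x).

Definition frameE (R : realType) (j : 'I_3) (x : 'rV[R]_3) : 'rV[R]_3 :=
  enorm x *: evec R j.

Definition cross (R : realType) (u v : 'rV[R]_3) : 'rV[R]_3 :=
  let i0 : 'I_3 := inord 0 in
  let i1 : 'I_3 := inord 1 in
  let i2 : 'I_3 := inord 2 in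
  (u 0 i1 * v 0 i2 - u 0 i2 * v 0 i1) *: evec R i0
  + (u 0 i2 * v 0 i0 - u 0 i0 * v 0 i2) *: evec R i1
  + (u 0 i0 * v 0 i1 - u 0 i1 * v 0 i0) *: evec R i2.

(** * Geometry of a map X : S -> S^2 x R read in the model and in a chart *)

Section immersion.
Context (R : realType) (S : topologicalType).
Implicit Types (c : chart R S) (X : S -> S2xR R) (z : 'rV[R]_2).

Definition local_rep c X : 'rV[R]_2 -> 'rV[R]_3 := to_model \o X \o cinv c.

Definition partial1 c X (a : 'I_2) : 'rV[R]_2 -> 'rV[R]_3 :=
  'D_(evec R a) (local_rep c X).

Definition partial2 c X (a b : 'I_2) : 'rV[R]_2 -> 'rV[R]_3 :=
  'D_(evec R a) (partial1 c X b).

Definition first_form c X z : 'M[R]_2 :=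
  \matrix_(a, b) mu2dot (local_rep c X z) (partial1 c X a z) (partial1 c X b z).

(* The Levi-Civita covariant derivative of X_b in the direction of X_a *)
Definition cov_deriv c X (a b : 'I_2) z : 'rV[R]_3 :=
  partial2 c X a b z +
  \row_(k < 3) \sum_(i < 3) \sum_(j < 3)
    christoffel (local_rep c X z) k i j
    * partial1 c X a z 0 i * partial1 c X b z 0 j.

(* Since d mu^2 is conformal to the Euclidean metric, its cross product is a
   positive multiple of the Euclidean one. *)
Definition unit_normal c X z : 'rV[R]_3 :=
  let n := cross (partial1 c X (inord 0) z) (partial1 c X (inord 1) z) in
  (Num.sqrt (mu2dot (local_rep c X z) n n))^-1 *: n.

Definition second_form c X z : 'M[R]_2 :=
  \matrix_(a, b)
    mu2dot (local_rep c X z) (cov_deriv c X a b z) (unit_normal c X z).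

Definition mean_curvature c X z : R :=
  2^-1 * \tr (invmx (first_form c X z) *m second_form c X z).

Definition normal_coord c X z (j : 'I_3) : R :=
  let x := local_rep c X z in
  mu2dot x (unit_normal c X z) (frameE j x).

Local Open Scope complex_scope.

(* The extended complex plane is [option R[i]], with [None] for infinity. *)
Definition chart_gauss_map c X z : option R[i] :=
  let N1 := normal_coord c X z (inord 0) in
  let N2 := normal_coord c X z (inord 1) in
  let N3 := normal_coord c X z (inord 2) in
  if 1 + N3 == 0 then None else Some ((N1 +i* N2) / (1 + N3)%:C).

Local Close Scope complex_scope.

Context (M : oriented_riemannian_surface R S).

Definition conformal_immersion X : Prop :=
  (forall c, atlas M c ->
     smooth_on (cimg c) (local_rep c X)
     /\ forall z, cimg c z -> injective ('d (local_rep c X) z)) /\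
  exists2 rho : S -> R, (forall p, 0 < rho p) &
    forall c p, atlas M c -> cdom c p ->
      first_form c X (cmap c p) = rho p *: smetric M c (cmap c p).

Definition minimal X : Prop :=
  forall c z, atlas M c -> cimg c z -> mean_curvature c X z = 0.

(* The local Gauss maps agree on overlaps because the atlas is oriented. *)
Definition is_gauss_map X (g : S -> option R[i]) : Prop :=
  forall c p, atlas M c -> cdom c p -> g p = chart_gauss_map c X (cmap c p).

Definition vec_of_complex (w : R[i]) : 'rV[R]_2 :=
  let: Complex a b := w in a *: evec R (inord 0) + b *: evec R (inord 1).

(* The two standard charts of the Riemann sphere: w away from infinity, and
   1/w away from 0. The values at the excluded point are irrelevant. *)
Definition sphere_chart0 (w : option R[i]) : 'rV[R]_2 :=
  if w is Some w' then vec_of_complex w' else 0.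

Definition sphere_chart_oo (w : option R[i]) : 'rV[R]_2 :=
  if w is Some w' then vec_of_complex w'^-1 else 0.

Definition singular_map (g : S -> option R[i]) : Prop :=
  forall c p, atlas M c -> cdom c p ->
    (g p <> None ->
       ~ bijective ('d (sphere_chart0 \o g \o cinv c) (cmap c p))) /\
    (g p <> Some 0 ->
       ~ bijective ('d (sphere_chart_oo \o g \o cinv c) (cmap c p))).

End immersion.

(* Main.v *)
Require Import Defs.
From mathcomp Require Import all_boot all_order all_algebra.
From mathcomp Require Import all_classical all_reals all_analysis.
From mathcomp Require Import complex ring lra.

(** The point of R^3 \ {0} being x, the frame |x| d/dx_j is a multiple of the
    standard one, so the Gauss map is the Euclidean unit normal n of the surface
    followed by stereographic projection. It is singular exactly when
    n_u × n_v = 0, that is, when the surface has zero Euclidean Gauss curvature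
    (gauss_map_degenerate). The metric |x|^-2 dx^2 being conformal to the
    Euclidean one, minimality says that the trace of the Euclidean second
    fundamental form is -2 <x,n> / |x|^2 (mean_curvature_minimal_at).

    These two properties force dn = 0 (minimal_not_developable). Otherwise some
    coordinate t of n has a non-zero gradient at some point, and near that point
    n is a function of t. The surface is then developable: it is ruled by
    straight segments, the level curves of t, along which n and f = <x,n> are
    constant. Along a ruling the inverse of the non-zero principal curvature is
    an affine function of the arc length. But minimality makes it equal to
    -|x|^2 / (2 f), a polynomial of degree exactly two: a contradiction.

    To avoid the arc length of the rulings, write m = dn/dt, p = df/dt = <x,m>
    and q = dp/dt - <x, dm/dt>. All of n, m, dm/dt, f, p, dp/dt are constant
    along the level curves of t (level_slope), because the derivative with
    respect to t of a function of t is again a function of t; this is where the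
    symmetry of second derivatives enters (derive_sym). Minimality becomes
    |x|^2 |m|^2 = 2 f q, and the ruling direction is n × m. Deriving the identity
    twice in that direction leaves |m|^4 = 0, up to non-zero factors.

    So n is locally constant, hence so is the Gauss map g, which is therefore
    constant on the connected surface (gauss_map_cst). As g determines n
    (stereo_inj), n is one and the same vector a in all charts. The second
    fundamental form vanishes, so minimality reads <x,a> = 0
    (normal_orth_position): the surface lies in the plane orthogonal to a, which
    is the cylinder over the great circle orthogonal to a. *)

Set Implicit Arguments.
Unset Strict Implicit.
Unset Printing Implicit Defensive.
Import Order.TTheory GRing.Theory Num.Theory.
Import numFieldNormedType.Exports.
Local Open Scope classical_set_scope.
Local Open Scope ring_scope.

(** * Calculus of functions of class C^n *)

Lemma near_eq_differentiable (R : numFieldType) (V W : normedModType R)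
    (f g : V -> W) (a : V) :
  {near a, f =1 g} -> differentiable f a -> differentiable g a.
Proof.
move=> fg df.
have ns : \forall h \near (0 : V), f (h + a) = g (h + a).
  have cs : h + a @[h --> (0 : V)] --> a.
    by rewrite -[X in _ --> X]add0r; apply: cvgD; [exact: cvg_id|exact: cvg_cst].
  exact: (cs _ fg).
have h0 : (g - f) \o shift a = cst ((g - f) a) + (0 : V -> W) +o_ 0 id.
  apply/eqaddoP => e e0; near=> h.
  rewrite !fctE /= !addr0 -(nbhs_singleton fg) subrr subr0.
  rewrite (_ : g (h + a) = f (h + a)) ?subrr ?normr0.
    exact: mulr_ge0 (ltW e0) _.
  by apply/esym; near: h; exact: ns.
have c0 : continuous (0 : V -> W) by move=> ?; exact: cst_continuous.
have d0 : differentiable (g - f) a.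
  apply/diff_locallyP.
  pose l : {linear V -> W} := \0%R.
  by rewrite (diff_unique (df := l) c0 h0).
by rewrite -(subrK f g); apply: differentiableD.
Unshelve. all: by end_near. Qed.

Section Ck_theory.
Context {R : realType} {V : normedModType R}.
Implicit Types (U : set V) (n : nat).

Lemma CkS (W : normedModType R) n U (f : V -> W) : Ck n.+1 U f -> Ck n U f.
Proof.
elim: n f => [|n IH] f [df Df].
  by move=> x Ux; apply/differentiable_continuous/df.
by split=> // v; apply: IH; apply: Df.
Qed.

Lemma Ck_sub (W : normedModType R) n U U' (f : V -> W) :
  U' `<=` U -> Ck n U f -> Ck n U' f.
Proof.
move=> UU'; elim: n f => [|n IH] f; first by move=> h x /UU' /h.
by case=> df Df; split=> [x /UU' /df//|v]; exact: IH (Df v).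
Qed.

Lemma Ck_eq (W : normedModType R) n U (f g : V -> W) :
  open U -> (forall x, U x -> f x = g x) -> Ck n U f -> Ck n U g.
Proof.
move=> oU; elim: n f g => [|n IH] f g fg.
  move=> cf x Ux; suff : g @ x --> g x by [].
  rewrite -[X in _ --> X]fg//.
  apply: cvg_trans (cf x Ux); apply: near_eq_cvg.
  by move/open_nbhs_nbhs: (conj oU Ux); apply: filterS => y /fg.
have nfg x : U x -> {near x, f =1 g}.
  by move=> Ux; move/open_nbhs_nbhs: (conj oU Ux); apply: filterS => y /fg.
case=> df Df; split=> [x Ux|v]; first exact: near_eq_differentiable (nfg x Ux) (df x Ux).
by apply: IH (Df v) => x Ux; apply: near_eq_derive; apply: nfg.
Qed.

Lemma Ck_cst (W : normedModType R) n U (k : W) : Ck n U (fun=> k : W).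
Proof.
elim: n k => [|n IH] k; first by move=> x _; exact: cst_continuous.
split=> [x _|v]; first exact: differentiable_cst.
rewrite (_ : 'D_v _ = fun=> 0); first exact: IH.
by apply/funext => x; rewrite derive_cst.
Qed.

Lemma CkD n U (f g : V -> R) : open U ->
  Ck n U f -> Ck n U g -> Ck n U (fun z => f z + g z).
Proof.
move=> oU; elim: n f g => [|n IH] f g.
  by move=> cf cg x Ux; apply: cvgD; [exact: cf|exact: cg].
move=> [df Df] [dg Dg]; split=> [x Ux|v]; first exact: differentiableD (df x Ux) (dg x Ux).
apply: Ck_eq (IH _ _ (Df v) (Dg v)) => // x Ux.
by rewrite -deriveD//; apply: diff_derivable; [exact: df|exact: dg].
Qed.

Lemma CkM n U (f g : V -> R) : open U ->
  Ck n U f -> Ck n U g -> Ck n U (fun z => f z * g z).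
Proof.
move=> oU; elim: n f g => [|n IH] f g.
  by move=> cf cg x Ux; apply: cvgM; [exact: cf|exact: cg].
move=> Cf Cg; have [df Df] := Cf; have [dg Dg] := Cg.
split=> [x Ux|v]; first exact: differentiableM (df x Ux) (dg x Ux).
apply: Ck_eq (CkD oU (IH _ _ (CkS Cf) (Dg v)) (IH _ _ (CkS Cg) (Df v))) => //.
move=> x Ux; rewrite -[RHS]/('D_v (f * g) x) deriveM//.
  by apply: diff_derivable; exact: df.
by apply: diff_derivable; exact: dg.
Qed.

Lemma CkV n U (f : V -> R) : open U -> (forall z, U z -> f z != 0) ->
  Ck n U f -> Ck n U (fun z => (f z)^-1).
Proof.
move=> oU f0; elim: n f f0 => [|n IH] f f0.
  by move=> cf x Ux; apply: cvgV; [exact: f0|exact: cf].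
move=> Cf; have [df Df] := Cf.
split=> [x Ux|v]; first exact: differentiableV (df x Ux) (f0 x Ux).
have CV := IH _ f0 (CkS Cf).
apply: Ck_eq (CkM oU (CkM oU (CkM oU CV CV) (@Ck_cst R n U (-1))) (Df v)) => //.
move=> x Ux; rewrite deriveV ?f0//; last exact/diff_derivable/df.
rewrite /= mulrN1 -invfM expr2; reflexivity.
Qed.

Lemma derive_sqrt_comp (f : V -> R) (x v : V) : differentiable f x -> 0 < f x ->
  differentiable (fun z => Num.sqrt (f z)) x /\
  'D_v (fun z => Num.sqrt (f z)) x = (2 * Num.sqrt (f x))^-1 * 'D_v f x.
Proof.
move=> df f0; have ds : differentiable (@Num.sqrt R) (f x).
  by apply/derivable1_diffP; have [] := is_derive1_sqrt f0.
have dc := differentiable_comp df ds; split=> //.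
rewrite deriveE// diff_comp//= deriveE//.
have := deriv1E (proj2 (derivable1_diffP _ _) ds) => /(congr1 (fun h => h ('d f x v))) ->.
rewrite derive1E (derive_sqrt f0); exact: mulrC.
Qed.

Lemma Ck_sqrt n U (f : V -> R) : open U -> (forall z, U z -> 0 < f z) ->
  Ck n U f -> Ck n U (fun z => Num.sqrt (f z)).
Proof.
move=> oU f0; elim: n f f0 => [|n IH] f f0.
  move=> cf x Ux; apply: (@continuous_comp _ _ _ f (@Num.sqrt R)).
    exact: cf.
  exact: sqrt_continuous.
move=> Cf; have [df Df] := Cf.
split=> [x Ux|v]; first by have [] := derive_sqrt_comp 0 (df x Ux) (f0 x Ux).
have Cs := IH _ f0 (CkS Cf).
have C2 : Ck n U (fun z => (2 * Num.sqrt (f z))^-1).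
  apply: CkV => //; last exact: CkM (Ck_cst _ _ _) Cs.
  by move=> z Uz; rewrite mulf_neq0// gt_eqF// sqrtr_gt0 f0.
apply: Ck_eq (CkM oU C2 (Df v)) => // x Ux.
by have [_ ->] := derive_sqrt_comp v (df x Ux) (f0 x Ux).
Qed.

Lemma Ck_coord k n U (F : V -> 'rV[R]_k) (i : 'I_k) : open U ->
  Ck n U F -> Ck n U (fun z => F z 0 i).
Proof.
move=> oU; elim: n F => [|n IH] F.
  move=> cF x Ux; apply: (@continuous_comp _ _ _ F (fun M : 'rV[R]_k => M 0 i)).
    exact: cF.
  exact: coord_continuous.
move=> [dF DF]; split=> [x Ux|v].
  exact: (differentiable_comp (dF x Ux) (differentiable_coord _ 0 i)).
apply: Ck_eq (IH _ (DF v)) => // x Ux.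
by rewrite derive_mx ?mxE//; apply/diff_derivable/dF.
Qed.

End Ck_theory.

Section smooth_theory.
Context {R : realType} {V : normedModType R}.
Implicit Types (U : set V) (f g : V -> R).

Lemma smooth_differentiable (W : normedModType R) U (F : V -> W) z :
  smooth_on U F -> U z -> differentiable F z.
Proof. by move=> /(_ 1%N)[+ _]; apply. Qed.

Lemma smooth_derivable (W : normedModType R) U (F : V -> W) z v :
  smooth_on U F -> U z -> derivable F z v.
Proof. by move=> sF Uz; apply/diff_derivable/smooth_differentiable/Uz. Qed.

Lemma smooth_continuous (W : normedModType R) U (F : V -> W) z :
  smooth_on U F -> U z -> {for z, continuous F}.
Proof. by move=> /(_ 0%N); apply. Qed.

Lemma smooth_derive (W : normedModType R) U (F : V -> W) v :
  smooth_on U F -> smooth_on U ('D_v F).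
Proof. by move=> sF n; have [_] := sF n.+1; apply. Qed.

Lemma smooth_sub (W : normedModType R) U U' (F : V -> W) :
  U' `<=` U -> smooth_on U F -> smooth_on U' F.
Proof. by move=> UU' sF n; apply: Ck_sub (sF n). Qed.

Lemma smooth_eq (W : normedModType R) U (F G : V -> W) :
  open U -> (forall x, U x -> F x = G x) -> smooth_on U F -> smooth_on U G.
Proof. by move=> oU FG sF n; apply: Ck_eq (sF n). Qed.

Lemma smooth_cst (W : normedModType R) U (k : W) : smooth_on U (fun=> k : W).
Proof. by move=> n; apply: Ck_cst. Qed.

Lemma smoothD U f g : open U ->
  smooth_on U f -> smooth_on U g -> smooth_on U (fun z => f z + g z).
Proof. by move=> oU sf sg n; apply: CkD. Qed.

Lemma smoothM U f g : open U ->
  smooth_on U f -> smooth_on U g -> smooth_on U (fun z => f z * g z).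
Proof. by move=> oU sf sg n; apply: CkM. Qed.

Lemma smoothB U f g : open U ->
  smooth_on U f -> smooth_on U g -> smooth_on U (fun z => f z - g z).
Proof.
move=> oU sf sg; apply: smoothD => //.
apply: smooth_eq (smoothM oU (smooth_cst U (-1 : R)) sg) => // x _.
by rewrite mulN1r.
Qed.

Lemma smoothV U f : open U -> (forall z, U z -> f z != 0) ->
  smooth_on U f -> smooth_on U (fun z => (f z)^-1).
Proof. by move=> oU f0 sf n; apply: CkV. Qed.

Lemma smooth_sqrt U f : open U -> (forall z, U z -> 0 < f z) ->
  smooth_on U f -> smooth_on U (fun z => Num.sqrt (f z)).
Proof. by move=> oU f0 sf n; apply: Ck_sqrt. Qed.

Lemma smooth_coord k U (F : V -> 'rV[R]_k) (i : 'I_k) : open U ->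
  smooth_on U F -> smooth_on U (fun z => F z 0 i).
Proof. by move=> oU sF n; apply: Ck_coord. Qed.

Lemma derive_near_cst U (f : V -> R) (z w : V) (k : R) : open U -> U z ->
  (forall y, U y -> f y = k) -> 'D_w f z = 0.
Proof.
move=> oU Uz fk; rewrite -(derive_cst k z w); apply: near_eq_derive.
by move/open_nbhs_nbhs: (conj oU Uz); apply: filterS.
Qed.

Lemma open_neq0 U (f : V -> R) : open U -> smooth_on U f -> open [set z | U z /\ f z != 0].
Proof.
move=> oU sf; rewrite openE => z [Uz fz0].
have cf := smooth_continuous sf Uz.
have nf : \forall y \near z, f y != 0.
  by apply: (cf [set r | r != 0]); apply: open_nbhs_nbhs; split=> //; exact: open_neq.
exact: filterS2 (open_nbhs_nbhs (conj oU Uz)) nf.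
Qed.

End smooth_theory.

(** * Mean values along segments and symmetry of second derivatives *)

Section line_calculus.
Context {R : realType} {V : normedModType R}.

Lemma is_derive_line (F : V -> R) (z v : V) (s : R) :
  differentiable F (z + s *: v) ->
  is_derive s 1 (fun t : R => F (z + t *: v)) ('D_v F (z + s *: v)).
Proof.
move=> dF.
have dl : is_diff s (fun t : R => z + t *: v) (0 + *:%R^~ v) by apply: is_diffD.
have dFl : is_diff (z + s *: v) F ('d F (z + s *: v)) by exact: differentiableP.
have dc := is_diff_comp dl dFl.
apply: DeriveDef; first by apply: diff_derivable; apply: ex_diff.
rewrite deriveE; last exact: ex_diff.
by rewrite diff_val /= fctE add0r scale1r deriveE.
Qed.

Lemma MVT_line (F : V -> R) (z v : V) (h : R) : 0 < h ->
  (forall s, 0 <= s <= h -> differentiable F (z + s *: v)) ->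
  exists2 s, 0 < s < h & F (z + h *: v) - F z = 'D_v F (z + s *: v) * h.
Proof.
move=> h0 dF.
have [s] : exists2 s : R, s \in `]0, h[%R &
    F (z + h *: v) - F (z + 0 *: v) = 'D_v F (z + s *: v) * (h - 0).
  apply: (@MVT R (fun t => F (z + t *: v)) (fun t => 'D_v F (z + t *: v)) 0 h h0).
    move=> x; rewrite in_itv /= => /andP[x0 xh].
    by apply: is_derive_line; apply: dF; rewrite !ltW.
  apply: derivable_within_continuous => x; rewrite in_itv /= => /dF dx.
  by have [] := is_derive_line dx.
rewrite in_itv /= => sh; rewrite scale0r addr0 subr0 => e.
by exists s.
Qed.

(** The mean value theorem is applied to y |-> f (y + h v) - f y along u, then
    to 'D_u f along v. The left-hand side is symmetric in u and v, which is what
    the symmetry of second derivatives rests on. *)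
Lemma second_difference U (f : V -> R) (z u v : V) (h : R) : 0 < h ->
  open U -> Ck 2 U f ->
  (forall s t, 0 <= s <= h -> 0 <= t <= h -> U (z + s *: u + t *: v)) ->
  exists s t, [/\ 0 < s < h, 0 < t < h &
    f (z + h *: u + h *: v) - f (z + h *: u) - (f (z + h *: v) - f z) =
    'D_v ('D_u f) (z + s *: u + t *: v) * h * h].
Proof.
move=> h0 oU [df Df] Uz; have hh : 0 <= h <= h by rewrite lexx ltW.
have h00 : 0 <= (0 : R) <= h by rewrite lexx ltW.
have U0 s : 0 <= s <= h -> U (z + s *: u).
  by move=> sh; have := Uz s 0 sh h00; rewrite scale0r addr0.
pose G y := f (y + h *: v) - f y.
have dfs y : U (y + h *: v) -> differentiable (fun x => f (x + h *: v)) y.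
  move=> Uy; apply: (@differentiable_comp _ _ _ _ (fun x => x + h *: v) f) => //.
  exact: df.
have dG y : U y -> U (y + h *: v) -> differentiable G y.
  by move=> Uy Uyh; apply: differentiableB; [exact: dfs|exact: df].
have [s sh eG] : exists2 s, 0 < s < h &
    G (z + h *: u) - G z = 'D_u G (z + s *: u) * h.
  by apply: MVT_line => // s sh; apply: dG; [exact: U0|exact: Uz].
have sh' : 0 <= s <= h by case/andP: sh => *; rewrite !ltW.
have eD : 'D_u G (z + s *: u) =
    'D_u f (z + s *: u + h *: v) - 'D_u f (z + s *: u).
  have d1 := dfs _ (Uz s h sh' hh); have d2 := df _ (U0 _ sh').
  rewrite [LHS](deriveB (f := fun x => f (x + h *: v)) (g := f)); last 2 first.
  - exact: diff_derivable.
  - exact: diff_derivable.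
  congr (_ - _); rewrite /derive.
  apply: (congr1 (fun F : R -> R => lim (F k @[k --> 0^']))).
  by apply/funext => k; rewrite /= -!addrA.
have [t th eD2] := @MVT_line ('D_u f) (z + s *: u) v h h0 (fun t th =>
  (Df u).1 _ (Uz s t sh' th)).
exists s, t; split=> //.
by rewrite -eD2 -eD -eG.
Qed.

(** If the two values differed, they would still differ by continuity at any two
    points near z, whereas a second difference at a small scale h is h^2 times a
    value near z of each of the two derivatives. *)
Lemma derive_sym U (f : V -> R) (z u v : V) : open U -> Ck 2 U f -> U z ->
  'D_v ('D_u f) z = 'D_u ('D_v f) z.
Proof.
move=> oU Cf Uz; have [_ Df] := Cf.
have cuv : {for z, continuous ('D_v ('D_u f))} by have [_ h] := Df u; exact: (h v z Uz).
have cvu : {for z, continuous ('D_u ('D_v f))} by have [_ h] := Df v; exact: (h u z Uz).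
apply: contrapT => /eqP neq.
pose e := `|'D_v ('D_u f) z - 'D_u ('D_v f) z| / 2.
have e0 : 0 < e by rewrite divr_gt0// normr_gt0 subr_eq0.
have : \forall y \near z, [/\ U y, `|'D_v ('D_u f) z - 'D_v ('D_u f) y| < e &
    `|'D_u ('D_v f) z - 'D_u ('D_v f) y| < e].
  have n1 : \forall y \near z, `|'D_v ('D_u f) z - 'D_v ('D_u f) y| < e.
    by move/cvgrPdist_lt : cuv; apply.
  have n2 : \forall y \near z, `|'D_u ('D_v f) z - 'D_u ('D_v f) y| < e.
    by move/cvgrPdist_lt : cvu; apply.
  exact: filterS3 (open_nbhs_nbhs (conj oU Uz)) n1 n2.
move=> /nbhs_ballP[r /= r0 rP].
(* The summand 1 covers the case where u and v both vanish. *)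
pose h := r / (`|u| + `|v| + 1).
have k0 : 0 < `|u| + `|v| + 1 by rewrite ltr_wpDl// addr_ge0.
have h0 : 0 < h by rewrite divr_gt0.
have Bz s t : 0 <= s <= h -> 0 <= t <= h -> ball z r (z + s *: u + t *: v).
  move=> /andP[s0 sh] /andP[t0 th]; rewrite -ball_normE /=.
  rewrite -addrA opprD addrA subrr add0r normrN.
  apply: (le_lt_trans (ler_normD _ _)); rewrite !normrZ !ger0_norm//.
  apply: (@le_lt_trans _ _ (h * `|u| + h * `|v|)).
    by rewrite lerD// ler_wpM2r.
  rewrite -mulrDr -[ltRHS](divfK (lt0r_neq0 k0)) ltr_pM2l//.
  by rewrite ltrDl.
have Bz' s t : 0 <= s <= h -> 0 <= t <= h -> ball z r (z + s *: v + t *: u).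
  by move=> sh th; rewrite addrAC; apply: Bz.
have [s [t [sh th E1]]] := second_difference h0 oU Cf
   (fun s t sh th => let: And3 a _ _ := rP _ (Bz s t sh th) in a).
have [s' [t' [sh' th' E2]]] := second_difference h0 oU Cf
   (fun s t sh th => let: And3 a _ _ := rP _ (Bz' s t sh th) in a).
have lt_le (x : R) : 0 < x < h -> 0 <= x <= h by move=> /andP[? ?]; rewrite !ltW.
have [_ A1 _] := rP _ (Bz s t (lt_le _ sh) (lt_le _ th)).
have [_ _ A2] := rP _ (Bz' s' t' (lt_le _ sh') (lt_le _ th')).
(* Both are the second difference divided by h^2. *)
have E : 'D_v ('D_u f) (z + s *: u + t *: v) =
         'D_u ('D_v f) (z + s' *: v + t' *: u).
  apply: (mulIf (lt0r_neq0 h0)); apply: (mulIf (lt0r_neq0 h0)).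
  have aux (a b c d : R) : a - b - (c - d) = a - c - (b - d) by ring.
  apply: (etrans (esym E1)); apply: etrans E2.
  rewrite (addrAC z (h *: v) (h *: u)); exact: aux.
have aux (a b c : R) : `|a - b| < e -> `|c - b| < e -> `|a - c| < e + e.
  move=> ab cb; rewrite -(subrKA b); apply: (le_lt_trans (ler_normD _ _)).
  by rewrite (distrC b) ltrD.
rewrite -E in A2; have := aux _ _ _ A1 A2.
by rewrite /e -splitr ltxx.
Qed.

Lemma derive_eq0_ball (F : V -> R) (z y : V) (r : R) :
  (forall x, ball z r x -> differentiable F x /\ forall v, 'D_v F x = 0) ->
  ball z r y -> F y = F z.
Proof.
move=> dF zy.
have zs s : 0 <= s <= 1 -> ball z r (z + s *: (y - z)).
  move=> /andP[s0 s1]; move: zy; rewrite -!ball_normE /=.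
  rewrite opprD addrA subrr add0r normrN normrZ ger0_norm// distrC.
  by apply: le_lt_trans; rewrite ler_piMl.
have [s sh] := @MVT_line F z (y - z) 1 ltr01 (fun s sh => (dF _ (zs s sh)).1).
have sh' : 0 <= s <= 1 by case/andP: sh => *; rewrite !ltW.
rewrite scale1r (proj2 (dF _ (zs s sh'))) mul0r (addrC z) subrK.
by move=> /eqP; rewrite subr_eq0 => /eqP.
Qed.

End line_calculus.

(** * Dot and cross products *)

Section space_vectors.
Context {R : realType}.
Implicit Types (u v w : 'rV[R]_3) (a : R).

Local Notation i0 := (inord 0 : 'I_3).
Local Notation i1 := (inord 1 : 'I_3).
Local Notation i2 := (inord 2 : 'I_3).

Lemma ord3E (i : 'I_3) : [\/ i = i0, i = i1 | i = i2].
Proof.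
case: i => [[|[|[|//]]] h]; [constructor 1|constructor 2|constructor 3];
  by apply/val_inj; rewrite /= inordK.
Qed.

Lemma ord2P (i : 'I_2) : i = 0 \/ i = 1.
Proof. by case: i => [[|[|//]] h]; [left|right]; apply/val_inj. Qed.

Lemma inord2_0 : inord 0 = 0 :> 'I_2.
Proof. by apply/val_inj; rewrite /= inordK. Qed.

Lemma inord2_1 : inord 1 = 1 :> 'I_2.
Proof. by apply/val_inj; rewrite /= inordK. Qed.

Lemma dot3E u v : dot u v = u 0 i0 * v 0 i0 + u 0 i1 * v 0 i1 + u 0 i2 * v 0 i2.
Proof.
rewrite /dot mxE !big_ord_recl big_ord0 addr0 !mxE addrA.
by congr (_ * _ + _ * _ + _ * _); congr (_ 0 _); apply/val_inj; rewrite /= inordK.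
Qed.

Lemma rowv3P u v :
  u 0 i0 = v 0 i0 -> u 0 i1 = v 0 i1 -> u 0 i2 = v 0 i2 -> u = v.
Proof.
by move=> h0 h1 h2; apply/rowP => i; case: (ord3E i) => ->.
Qed.

Lemma cross0E u v : cross u v 0 i0 = u 0 i1 * v 0 i2 - u 0 i2 * v 0 i1.
Proof. by rewrite /cross !mxE /= -!val_eqE /= !inordK//= !(mulr0, mulr1, addr0). Qed.

Lemma cross1E u v : cross u v 0 i1 = u 0 i2 * v 0 i0 - u 0 i0 * v 0 i2.
Proof. by rewrite /cross !mxE /= -!val_eqE /= !inordK//= !(mulr0, mulr1, addr0, add0r). Qed.

Lemma cross2E u v : cross u v 0 i2 = u 0 i0 * v 0 i1 - u 0 i1 * v 0 i0.
Proof. by rewrite /cross !mxE /= -!val_eqE /= !inordK//= !(mulr0, mulr1, addr0, add0r). Qed.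

Definition crossE := (cross0E, cross1E, cross2E).

Lemma dotC n (x y : 'rV[R]_n) : dot x y = dot y x.
Proof. by rewrite /dot !mxE; apply: eq_bigr => i _; rewrite !mxE mulrC. Qed.

Lemma dotDl n (x y z : 'rV[R]_n) : dot (x + y) z = dot x z + dot y z.
Proof. by rewrite /dot mulmxDl mxE. Qed.

Lemma dotZl n a (x y : 'rV[R]_n) : dot (a *: x) y = a * dot x y.
Proof. by rewrite /dot -scalemxAl mxE. Qed.

Lemma dotZr n a (x y : 'rV[R]_n) : dot x (a *: y) = a * dot x y.
Proof. by rewrite dotC dotZl dotC. Qed.

Lemma dotNl n (x y : 'rV[R]_n) : dot (- x) y = - dot x y.
Proof. by rewrite -scaleN1r dotZl mulN1r. Qed.

Lemma dot0l n (x : 'rV[R]_n) : dot 0 x = 0.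
Proof. by rewrite -(scale0r 0) dotZl mul0r. Qed.

Lemma dot0r n (x : 'rV[R]_n) : dot x 0 = 0.
Proof. by rewrite dotC dot0l. Qed.

Lemma dot_evec n (x : 'rV[R]_n) i : dot x (evec R i) = x 0 i.
Proof.
rewrite /dot mxE (bigD1 i) //= big1 ?addr0 ?mxE ?eqxx ?mulr1// => j ji.
by rewrite !mxE (negbTE ji) andbF mulr0.
Qed.

Lemma dot_gt0 n (x : 'rV[R]_n) : x != 0 -> 0 < dot x x.
Proof.
move=> x0; have s0 i : 0 <= x 0 i * x^T i 0 by rewrite mxE -expr2 sqr_ge0.
rewrite lt_neqAle eq_sym /dot mxE sumr_ge0 ?andbT//.
apply: contra x0 => /eqP/psumr_eq0P h; apply/eqP/rowP => i; rewrite !mxE.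
by have /eqP := h (fun i _ => s0 i) i isT; rewrite mxE mulf_eq0 orbb => /eqP.
Qed.

Lemma crossC u v : cross u v = - cross v u.
Proof. by apply: rowv3P; rewrite [RHS]mxE !crossE; ring. Qed.

Lemma crossZl a u v : cross (a *: u) v = a *: cross u v.
Proof. by apply: rowv3P; rewrite [RHS]mxE !crossE !mxE; ring. Qed.

Lemma cross_cross u v w : cross (cross u v) w = dot u w *: v - dot v w *: u.
Proof.
by apply: rowv3P;
  rewrite [RHS]mxE [in RHS]mxE [X in _ + X]mxE [in X in _ + X]mxE !crossE !dot3E; ring.
Qed.

Lemma dot_cross_cross u v :
  dot (cross u v) (cross u v) = dot u u * dot v v - dot u v ^+ 2.
Proof. by rewrite !dot3E !crossE; ring. Qed.

Lemma cross0l v : cross 0 v = 0.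
Proof. by rewrite -(scale0r v) crossZl !scale0r. Qed.

(** Used for tangent vectors u, v and for the derivatives of the normal w: both
    pairs are orthogonal to w, so their cross products are multiples of w. *)
Lemma cross_orth u v w : dot w w = 1 -> dot u w = 0 -> dot v w = 0 ->
  cross u v = dot (cross u v) w *: w.
Proof.
move=> w1 uw vw.
have h : cross w (cross u v) = 0.
  by rewrite crossC cross_cross uw vw !scale0r subrr oppr0.
have := cross_cross w (cross u v) w; rewrite h cross0l w1 scale1r => /esym/eqP.
by rewrite subr_eq0 => /eqP.
Qed.

Lemma cross_eq0_minor u v i j : cross u v = 0 -> u 0 i * v 0 j = v 0 i * u 0 j.
Proof.
move=> uv0; have := cross_cross u v (evec R i).
rewrite uv0 cross0l !dot_evec => /esym/rowP/(_ j); rewrite !mxE => /eqP.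
by rewrite subr_eq0 => /eqP.
Qed.

Lemma dotBZl k (a b : R) (x y z : 'rV[R]_k) :
  dot (a *: x - b *: y) z = a * dot x z - b * dot y z.
Proof. by rewrite dotDl dotNl !dotZl. Qed.

Lemma dot_sqB k (a b : R) (x y : 'rV[R]_k) :
  dot (a *: x - b *: y) (a *: x - b *: y) =
  a ^+ 2 * dot x x - 2 * a * b * dot x y + b ^+ 2 * dot y y.
Proof.
rewrite dotBZl !(dotC _ (_ - _)) !dotBZl (dotC y x); ring.
Qed.

(** Matches the two ways in which the ruling direction arises: as a combination
    of partial derivatives, and as an expanded double cross product. *)
Lemma scale_swap k (q a b : R) (x y : 'rV[R]_k) :
  q *: (a *: x - b *: y) = - ((b * q) *: y - (a * q) *: x).
Proof. by rewrite opprB scalerBr !scalerA !(mulrC q). Qed.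

Lemma cross0r (a : 'rV[R]_3) : cross a 0 = 0.
Proof. by rewrite crossC cross0l oppr0. Qed.

Lemma dot_cross_l (a b : 'rV[R]_3) : dot a (cross a b) = 0.
Proof. by rewrite !dot3E !crossE; ring. Qed.

Lemma dot_cross_r (a b : 'rV[R]_3) : dot b (cross a b) = 0.
Proof. by rewrite !dot3E !crossE; ring. Qed.

End space_vectors.

(** * Derivatives of vector-valued functions *)

Section vector_calculus.
Context {R : realType} {V : normedModType R}.
Implicit Types (U : set V) (w : V).

Lemma derive_coord k (F : V -> 'rV[R]_k) z w i : derivable F z w ->
  'D_w F z 0 i = 'D_w (fun y => F y 0 i) z.
Proof. by move=> dF; rewrite derive_mx// mxE. Qed.

Lemma derivable_coord k (F : V -> 'rV[R]_k) z w i : derivable F z w ->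
  derivable (fun y => F y 0 i) z w.
Proof. by move=> /derivable_mxP. Qed.

Lemma derivable_rowP k (F : V -> 'rV[R]_k) z w :
  (forall i, derivable (fun y => F y 0 i) z w) -> derivable F z w.
Proof. by move=> dF; apply/derivable_mxP => i j; rewrite ord1. Qed.

Lemma derive_mul (f g : V -> R) z w : derivable f z w -> derivable g z w ->
  'D_w (fun y => f y * g y) z = 'D_w f z * g z + f z * 'D_w g z.
Proof.
move=> df dg; have := deriveM df dg; rewrite addrC => h.
by apply: (etrans h); congr (_ + _); exact: mulrC.
Qed.

Lemma derivable_mul (f g : V -> R) z w : derivable f z w -> derivable g z w ->
  derivable (fun y => f y * g y) z w.
Proof. by move=> df dg; have := derivableM df dg. Qed.

Lemma is_derive_dot (F G : V -> 'rV[R]_3) z w : derivable F z w -> derivable G z w ->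
  is_derive z w (fun y => dot (F y) (G y)) (dot ('D_w F z) (G z) + dot (F z) ('D_w G z)).
Proof.
move=> dF dG.
have dFi i := @derivable_coord _ F z w i dF; have dGi i := @derivable_coord _ G z w i dG.
have dm i := derivable_mul (dFi i) (dGi i).
rewrite (_ : (fun y => dot (F y) (G y)) = (fun y => F y 0 (inord 0) * G y 0 (inord 0))
  + (fun y => F y 0 (inord 1) * G y 0 (inord 1))
  + (fun y => F y 0 (inord 2) * G y 0 (inord 2))); last first.
  by apply/funext => y; rewrite dot3E.
apply: DeriveDef; first by apply: derivableD => //; apply: derivableD.
rewrite deriveD//; last exact: derivableD.
rewrite deriveD// !derive_mul// !dot3E !derive_coord//; ring.
Qed.

Lemma derive_dot (F G : V -> 'rV[R]_3) z w : derivable F z w -> derivable G z w ->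
  'D_w (fun y => dot (F y) (G y)) z = dot ('D_w F z) (G z) + dot (F z) ('D_w G z).
Proof. by move=> dF dG; have [] := is_derive_dot dF dG. Qed.

Lemma derivable_dot (F G : V -> 'rV[R]_3) z w : derivable F z w -> derivable G z w ->
  derivable (fun y => dot (F y) (G y)) z w.
Proof. by move=> dF dG; have [] := is_derive_dot dF dG. Qed.

Lemma is_derive_cross (F G : V -> 'rV[R]_3) z w : derivable F z w -> derivable G z w ->
  is_derive z w (fun y => cross (F y) (G y))
    (cross ('D_w F z) (G z) + cross (F z) ('D_w G z)).
Proof.
move=> dF dG.
have dFi i := @derivable_coord _ F z w i dF; have dGi i := @derivable_coord _ G z w i dG.
have dm i j := derivable_mul (dFi i) (dGi j).
have dB i j : derivable (fun y => F y 0 i * G y 0 j - F y 0 j * G y 0 i) z w.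
  exact: derivableB.
have EB i j : 'D_w (fun y => F y 0 i * G y 0 j - F y 0 j * G y 0 i) z =
   'D_w F z 0 i * G z 0 j + F z 0 i * 'D_w G z 0 j -
   ('D_w F z 0 j * G z 0 i + F z 0 j * 'D_w G z 0 i).
  by rewrite !derive_coord// -!derive_mul//; apply: deriveB.
have dc : derivable (fun y => cross (F y) (G y)) z w.
  apply: derivable_rowP => i; case: (ord3E i) => ->.
  - by under eq_fun do rewrite cross0E; exact: dB.
  - by under eq_fun do rewrite cross1E; exact: dB.
  - by under eq_fun do rewrite cross2E; exact: dB.
apply: DeriveDef => //; apply: rowv3P; rewrite derive_coord// [RHS]mxE !crossE.
- by under eq_fun do rewrite cross0E; rewrite EB; ring.
- by under eq_fun do rewrite cross1E; rewrite EB; ring.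
- by under eq_fun do rewrite cross2E; rewrite EB; ring.
Qed.

End vector_calculus.

Section smooth_vectors.
Context {R : realType} {V : normedModType R}.
Implicit Types (U : set V) (w : V).

(** Differentiability of a row vector follows from that of its entries by writing
    it as the sum of its entries times the basis vectors. *)
Lemma Ck_row k n U (F : V -> 'rV[R]_k) : open U ->
  (forall i, Ck n U (fun z => F z 0 i)) -> Ck n U F.
Proof.
move=> oU; elim: n F => [|n IH] F CF.
  move=> x Ux; apply/cvgrPdist_lt => e e0.
  have h (i : 'I_k) : \forall y \near x, `|F x 0 i - F y 0 i| < e.
    by have /cvgrPdist_lt := CF i x Ux; apply.
  have hh : \forall y \near x, forall i : 'I_k, `|F x 0 i - F y 0 i| < e.
    exact: filter_forall h.
  apply: (filterS _ hh) => y hy.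
  rewrite [ltLHS]/Num.Def.normr/= mx_normrE bigmax_lt//= => -[i j] _.
  by rewrite !mxE ord1 hy.
have dF x : U x -> differentiable F x.
  move=> Ux.
  rewrite (_ : F = \sum_(i < k) (fun z => F z 0 i *: (delta_mx 0 i : 'rV[R]_k))).
    apply: differentiable_sum => i; apply: differentiableZl.
    by have [dFi _] := CF i; exact: (dFi x Ux).
  by apply/funext => z; rewrite [LHS]row_sum_delta fct_sumE.
split=> // v; apply: IH => i; have [_ Df] := CF i.
apply: Ck_eq (Df v) => // x Ux; rewrite derive_coord//.
exact/diff_derivable/dF.
Qed.

Lemma smooth_row k U (F : V -> 'rV[R]_k) : open U ->
  (forall i, smooth_on U (fun z => F z 0 i)) -> smooth_on U F.
Proof. by move=> oU sF n; apply: Ck_row => // i; apply: sF. Qed.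

Lemma smooth_dot U (F G : V -> 'rV[R]_3) : open U -> smooth_on U F -> smooth_on U G ->
  smooth_on U (fun y => dot (F y) (G y)).
Proof.
move=> oU sF sG; under eq_fun do rewrite dot3E.
have sm i := smoothM oU (smooth_coord i oU sF) (smooth_coord i oU sG).
by apply: smoothD => //; apply: smoothD.
Qed.

Lemma smoothZ k U (f : V -> R) (F : V -> 'rV[R]_k) : open U ->
  smooth_on U f -> smooth_on U F ->
  smooth_on U (fun y => f y *: F y).
Proof.
move=> oU sf sF; apply: smooth_row => // i; under eq_fun do rewrite mxE.
exact: smoothM oU sf (smooth_coord i oU sF).
Qed.

Lemma smooth_cross U (F G : V -> 'rV[R]_3) : open U -> smooth_on U F -> smooth_on U G ->
  smooth_on U (fun y => cross (F y) (G y)).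
Proof.
move=> oU sF sG; apply: smooth_row => // i.
have sm i j := smoothM oU (smooth_coord i oU sF) (smooth_coord j oU sG).
case: (ord3E i) => ->.
- by under eq_fun do rewrite cross0E; exact: smoothB.
- by under eq_fun do rewrite cross1E; exact: smoothB.
- by under eq_fun do rewrite cross2E; exact: smoothB.
Qed.

End smooth_vectors.

Section plane_derivatives.
Context {R : realType}.
Local Notation u := (evec R (0 : 'I_2)).
Local Notation v := (evec R (1 : 'I_2)).

Lemma row2_evec (w : 'rV[R]_2) : w = w 0 0 *: u + w 0 1 *: v.
Proof.
by apply/rowP => i; case: (ord2P i) => ->; rewrite !mxE /= !(mulr0, mulr1, addr0, add0r).
Qed.

Lemma derive_row2 (W : normedModType R) (F : 'rV[R]_2 -> W) (z w : 'rV[R]_2) :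
  differentiable F z ->
  'D_w F z = w 0 0 *: 'D_u F z + w 0 1 *: 'D_v F z.
Proof.
move=> dF; rewrite (deriveE w dF) (deriveE u dF) (deriveE v dF).
by rewrite {1}(row2_evec w) linearD !linearZ.
Qed.

End plane_derivatives.

(** * Functions constant along level curves *)

Section level_curves.
Context {R : realType} {V : normedModType R} (U : set V) (oU : open U) (u v : V).
Context (t : V -> R) (st : smooth_on U t).
Context (tv0 : forall z, U z -> 'D_v t z != 0).

(** The tangent direction of the level curve of t through z, scaled so as to be
    the Hamiltonian vector field of t. *)
Definition ruling z := 'D_v t z *: u - 'D_u t z *: v.

Definition level_cst {W : normedModType R} (F : V -> W) :=
  forall z, U z -> 'D_(ruling z) F z = 0.

(** If F = phi o t, this is (phi' o t); dividing by the derivative in the single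
    direction v suffices since the derivative of t in that direction does not
    vanish. *)
Definition slope {W : normedModType R} (F : V -> W) z := ('D_v t z)^-1 *: 'D_v F z.

Lemma derive_ruling (W : normedModType R) (F : V -> W) z : differentiable F z ->
  'D_(ruling z) F z = 'D_v t z *: 'D_u F z - 'D_u t z *: 'D_v F z.
Proof.
move=> dF; rewrite (deriveE (ruling z) dF) (deriveE u dF) (deriveE v dF).
by rewrite linearB !linearZ.
Qed.

Lemma derive_slope_v (W : normedModType R) (F : V -> W) z : U z ->
  'D_v F z = 'D_v t z *: slope F z.
Proof. by move=> Uz; rewrite /slope scalerA divff ?scale1r ?tv0. Qed.

Lemma derive_slope_u (W : normedModType R) (F : V -> W) z :
  differentiable F z -> level_cst F -> U z ->
  'D_u F z = 'D_u t z *: slope F z.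
Proof.
move=> dF lF Uz; have := lF z Uz; rewrite derive_ruling// => /eqP.
rewrite subr_eq0 => /eqP h; rewrite /slope scalerA mulrC -scalerA -h.
by rewrite scalerA mulVf ?scale1r ?tv0.
Qed.

Lemma smooth_slope (f : V -> R) : smooth_on U f -> smooth_on U (slope f).
Proof.
move=> sf; apply: smoothM => //; last exact: smooth_derive.
by apply: smoothV => //; exact: smooth_derive.
Qed.

(** With 'D_u f = 'D_u t * slope f and 'D_v f = 'D_v t * slope f, equating the two
    mixed derivatives of f cancels the terms that contain mixed derivatives of t,
    and leaves exactly that slope f is constant along the level curves. *)
Lemma level_cst_slope (f : V -> R) : smooth_on U f -> level_cst f -> level_cst (slope f).
Proof.
move=> sf lf z Uz; have ss := smooth_slope sf.
have dss := smooth_differentiable ss Uz.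
rewrite derive_ruling//.
have dt w y : U y -> derivable ('D_w t) y u /\ derivable ('D_w t) y v.
  by move=> Uy; split; apply: smooth_derivable Uy; apply: smooth_derive.
have eu : {near z, 'D_u f =1 (fun y => 'D_u t y * slope f y)}.
  move/open_nbhs_nbhs: (conj oU Uz); apply: filterS => y Uy.
  by apply: derive_slope_u => //; exact: smooth_differentiable sf Uy.
have ev : {near z, 'D_v f =1 (fun y => 'D_v t y * slope f y)}.
  move/open_nbhs_nbhs: (conj oU Uz); apply: filterS => y Uy.
  exact: derive_slope_v.
have := derive_sym u v oU (sf 2%N) Uz.
rewrite (near_eq_derive v eu) (near_eq_derive u ev).
have ds w := @diff_derivable _ _ _ _ _ w dss.
rewrite (@derive_mul _ _ ('D_u t) (slope f) z v (dt u z Uz).2 (ds v)).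
rewrite (@derive_mul _ _ ('D_v t) (slope f) z u (dt v z Uz).1 (ds u)).
rewrite (derive_sym u v oU (st 2%N) Uz) => /addrI h.
by apply/eqP; rewrite subr_eq0; apply/eqP/esym.
Qed.

Lemma slope_coord k (F : V -> 'rV[R]_k) i z : derivable F z v ->
  slope (fun y => F y 0 i) z = slope F z 0 i.
Proof. by move=> dF; rewrite /slope mxE derive_coord. Qed.

Lemma smooth_slope_row k (F : V -> 'rV[R]_k) : smooth_on U F -> smooth_on U (slope F).
Proof.
move=> sF; apply: smoothZ => //; last exact: smooth_derive.
by apply: smoothV => //; exact: smooth_derive.
Qed.

Lemma level_cst_rowP k (F : V -> 'rV[R]_k) : smooth_on U F ->
  level_cst F <-> forall i, level_cst (fun y => F y 0 i).
Proof.
move=> sF; split=> [lF i z Uz|lF z Uz].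
  by rewrite -derive_coord ?lF ?mxE//; exact: smooth_derivable sF Uz.
apply/rowP => i; rewrite derive_coord ?lF ?mxE//; exact: smooth_derivable sF Uz.
Qed.

Lemma level_cst_slope_row k (F : V -> 'rV[R]_k) : smooth_on U F ->
  level_cst F -> level_cst (slope F).
Proof.
move=> sF /(level_cst_rowP sF) lF; apply/(level_cst_rowP (smooth_slope_row sF)) => i z Uz.
rewrite -(level_cst_slope (smooth_coord i oU sF) (lF i) Uz).
apply: near_eq_derive; move/open_nbhs_nbhs: (conj oU Uz); apply: filterS => y Uy.
by rewrite slope_coord//; exact: smooth_derivable sF Uy.
Qed.

(** The differential form df = f' dt, with f' again a function of t: this is the
    form in which derivatives with respect to t are used below, and iterated. *)
Lemma level_slope (f : V -> R) : smooth_on U f -> level_cst f ->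
  exists f' : V -> R, [/\ smooth_on U f', level_cst f',
    (forall z, U z -> 'D_u f z = 'D_u t z * f' z) &
    (forall z, U z -> 'D_v f z = 'D_v t z * f' z)].
Proof.
move=> sf lf; exists (slope f); split.
- exact: smooth_slope.
- exact: level_cst_slope.
- by move=> z Uz; exact: (derive_slope_u (smooth_differentiable sf Uz) lf Uz).
- by move=> z Uz; exact: derive_slope_v Uz.
Qed.

Lemma level_slope_row k (F : V -> 'rV[R]_k) : smooth_on U F -> level_cst F ->
  exists F' : V -> 'rV[R]_k, [/\ smooth_on U F', level_cst F',
    (forall z, U z -> 'D_u F z = 'D_u t z *: F' z) &
    (forall z, U z -> 'D_v F z = 'D_v t z *: F' z)].
Proof.
move=> sF lF; exists (slope F); split.
- exact: smooth_slope_row.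
- exact: level_cst_slope_row.
- by move=> z Uz; exact: (derive_slope_u (smooth_differentiable sF Uz) lF Uz).
- by move=> z Uz; exact: derive_slope_v Uz.
Qed.

End level_curves.

(** * Developable surfaces are not minimal *)

Section scalar_identities.
Context {R : realType}.

(** Here E, F, G is the first fundamental form and Luu, Luv, Lvu, Lvv the second
    one, of rank one as n is a function of t; tu, tv are the derivatives of t, yy
    the square norm of the ruling direction y, D the area element, and mm = |m|^2.
    Minimality reads q yy xx = 2 f D^2 in these terms, and yy is eliminated by the
    last hypothesis. *)
Lemma ruling_identity (E F G Luu Luv Lvu Lvv q tu tv xx f D mm yy : R) : D != 0 ->
  (G * Luu - F * (Luv + Lvu) + E * Lvv) * xx + 2 * f * (E * G - F ^+ 2) = 0 ->
  Luu = - (tu * (tu * q)) -> Luv = - (tu * (tv * q)) ->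
  Lvu = - (tv * (tu * q)) -> Lvv = - (tv * (tv * q)) ->
  E * G - F ^+ 2 = D ^+ 2 ->
  yy = tv ^+ 2 * E - 2 * tv * tu * F + tu ^+ 2 * G ->
  q ^+ 2 * yy = D ^+ 2 * mm ->
  xx * mm = 2 * (f * q).
Proof.
move=> D0 h1 e1 e2 e3 e4 e5 e6 h2; apply: (mulfI (expf_neq0 2 D0)).
rewrite mulrCA -h2; apply/eqP; rewrite -subr_eq0; apply/eqP.
rewrite e5 in h1; rewrite -(mulr0 (- q)) -h1 e1 e2 e3 e4 e6; ring.
Qed.

Lemma cancel_opp_factor (D a c d e : R) : D != 0 ->
  - D * a * c = - (d * (- D * e)) -> a * c = - (d * e).
Proof.
move=> D0 h; apply: (mulfI D0); apply/eqP; rewrite -subr_eq0; apply/eqP.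
transitivity (- (- D * a * c - - (d * (- D * e)))); first by ring.
by rewrite h subrr oppr0.
Qed.

Lemma minimal_eq_swap (E F F' G a b c d xx f : R) : F = F' ->
  (G * a - F * (b + c) + E * d) * xx + 2 * f * (E * G - F ^+ 2) = 0 ->
  (E * d - F' * (c + b) + G * a) * xx + 2 * f * (G * E - F' ^+ 2) = 0.
Proof. by move=> <- <-; ring. Qed.

Lemma minimal_eq_flat (E F G a b c d xx f : R) : a = 0 -> b = 0 -> c = 0 -> d = 0 ->
  (G * a - F * (b + c) + E * d) * xx + 2 * f * (E * G - F ^+ 2) = 0 ->
  E * G - F ^+ 2 != 0 -> f = 0.
Proof.
move=> -> -> -> ->; rewrite !(mulr0, addr0, subr0, oppr0, mul0r, add0r) => /eqP.
by rewrite !mulf_eq0 pnatr_eq0 /= => /orP[/eqP //|/eqP ->]; rewrite eqxx.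
Qed.

End scalar_identities.

Section flat_minimal.

Context {R : realType} {V : normedModType R}.

(** The trace of the second fundamental form with respect to the first one equals
    -2 <x,n> / |x|^2, with denominators cleared. *)
Definition minimal_at (u v : V) (x n : V -> 'rV[R]_3) (z : V) : Prop :=
  let xu := 'D_u x z in let xv := 'D_v x z in
  (dot xv xv * dot ('D_u ('D_u x) z) (n z)
   - dot xu xv * (dot ('D_u ('D_v x) z) (n z) + dot ('D_v ('D_u x) z) (n z))
   + dot xu xu * dot ('D_v ('D_v x) z) (n z)) * dot (x z) (x z)
  + 2 * dot (x z) (n z) * (dot xu xu * dot xv xv - dot xu xv ^+ 2) = 0.

(** The j-th coordinate of n serves as the parameter t of the family of rulings,
    so that dn = m dt with m of j-th coordinate 1. The primes in the proof denote
    derivatives with respect to t; y and b are two vectors along the ruling. *)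
Lemma minimal_not_developable (U : set V) (u v : V) (x n : V -> 'rV[R]_3) (j : 'I_3) :
  open U -> smooth_on U x -> smooth_on U n ->
  (forall z, U z -> dot (n z) (n z) = 1) ->
  (forall z, U z -> dot ('D_u x z) (n z) = 0) ->
  (forall z, U z -> dot ('D_v x z) (n z) = 0) ->
  (forall z, U z -> cross ('D_u x z) ('D_v x z) != 0) ->
  (forall z, U z -> cross ('D_u n z) ('D_v n z) = 0) ->
  (forall z, U z -> minimal_at u v x n z) ->
  (forall z, U z -> 'D_v n z 0 j != 0) ->
  forall z, ~ U z.
Proof.
move=> oU sx sn n1 xun xvn xuv0 nuv0 mini nvj.
pose t z := n z 0 j.
have st : smooth_on U t by exact: smooth_coord.
have dn w z : U z -> derivable n z w by exact: smooth_derivable.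
have dx w z : U z -> derivable x z w by exact: smooth_derivable.
have tE w z : U z -> 'D_w t z = 'D_w n z 0 j.
  by move=> Uz; rewrite (derive_coord j (dn w z Uz)).
have tv0 z : U z -> 'D_v t z != 0 by move=> Uz; rewrite tE ?nvj.
have ln : level_cst U u v t n.
  move=> z Uz; rewrite derive_ruling; last exact: smooth_differentiable sn Uz.
  apply/rowP => i; rewrite !mxE !(tE _ _ Uz).
  by apply/eqP; rewrite subr_eq0; apply/eqP; exact: (esym (cross_eq0_minor j i (nuv0 z Uz))).
have [m [sm lm nu nv]] := level_slope_row oU st tv0 sn ln.
have [m' [sm' lm' mu mv]] := level_slope_row oU st tv0 sm lm.
have dm w z : U z -> derivable m z w by exact: smooth_derivable.
have dm' w z : U z -> derivable m' z w by exact: smooth_derivable.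
pose f z := dot (x z) (n z).
have sf : smooth_on U f by exact: smooth_dot.
have fE w z : U z -> 'D_w f z = dot ('D_w x z) (n z) + dot (x z) ('D_w n z).
  by move=> Uz; rewrite (derive_dot (dx w z Uz) (dn w z Uz)).
have xrul z : U z -> 'D_(ruling u v t z) x z = 'D_v t z *: 'D_u x z - 'D_u t z *: 'D_v x z.
  by move=> Uz; rewrite derive_ruling//; exact: smooth_differentiable sx Uz.
have yn z : U z -> dot ('D_(ruling u v t z) x z) (n z) = 0.
  by move=> Uz; rewrite (xrul _ Uz) dotBZl (xun _ Uz) (xvn _ Uz) !mulr0 subr0.
have lf : level_cst U u v t f.
  by move=> z Uz; rewrite (fE _ _ Uz) (yn _ Uz) (ln _ Uz) dot0r addr0.
have [p [sp lp fu fv]] := level_slope oU st tv0 sf lf.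
have [p' [sp' lp' pu pv]] := level_slope oU st tv0 sp lp.
have pE z : U z -> p z = dot (x z) (m z).
  move=> Uz; apply: (mulfI (tv0 z Uz)).
  by rewrite -(fv _ Uz) (fE _ _ Uz) (xvn _ Uz) add0r (nv _ Uz) dotZr.
have pE' w z : U z -> 'D_w p z = dot ('D_w x z) (m z) + dot (x z) ('D_w m z).
  move=> Uz; rewrite -(derive_dot (dx w z Uz) (dm w z Uz)); apply: near_eq_derive.
  by move/open_nbhs_nbhs: (conj oU Uz); apply: filterS => y Uy; rewrite pE.
pose q z := p' z - dot (x z) (m' z).
(* dp = <dx,m> + <x,dm>, where dp and dm are multiples of dt. *)
have xum z : U z -> dot ('D_u x z) (m z) = 'D_u t z * q z.
  move=> Uz; have := pE' u z Uz; rewrite (pu _ Uz) (mu _ Uz) dotZr /q mulrBr => ->.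
  by rewrite addrK.
have xvm z : U z -> dot ('D_v x z) (m z) = 'D_v t z * q z.
  move=> Uz; have := pE' v z Uz; rewrite (pv _ Uz) (mv _ Uz) dotZr /q mulrBr => ->.
  by rewrite addrK.
have nm z : U z -> dot (n z) (m z) = 0.
  move=> Uz; have := derive_near_cst v oU Uz n1.
  rewrite (derive_dot (dn v z Uz) (dn v z Uz)) (dotC (n z)) (nv _ Uz) dotZl => /eqP.
  rewrite -mulr2n mulrn_eq0 /= mulf_eq0 (negbTE (tv0 z Uz)) /= dotC.
  by move/eqP.
have m1 z : U z -> m z != 0.
  move=> Uz; apply/eqP => m0; have /rowP/(_ j) := nv z Uz.
  by rewrite m0 scaler0 mxE; apply/eqP/nvj.
pose y z := 'D_(ruling u v t z) x z.
pose b z := cross (n z) (m z).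
pose D z := dot (cross ('D_u x z) ('D_v x z)) (n z).
have xuvE z : U z -> cross ('D_u x z) ('D_v x z) = D z *: n z.
  by move=> Uz; apply: cross_orth; [exact: n1|exact: xun|exact: xvn].
have D0 z : U z -> D z != 0.
  by move=> Uz; have := xuv0 z Uz; rewrite (xuvE _ Uz) scaler_eq0 negb_or => /andP[].
(* Both sides are the cross product of x_u × x_v = D n with m. *)
have yb z : U z -> q z *: y z = - D z *: b z.
  move=> Uz; rewrite scaleNr -crossZl -(xuvE _ Uz) cross_cross (xum _ Uz) (xvm _ Uz).
  by rewrite /y (xrul _ Uz); exact: scale_swap.
have bb z : U z -> dot (b z) (b z) = dot (m z) (m z).
  by move=> Uz; rewrite dot_cross_cross (n1 _ Uz) (nm _ Uz) mul1r expr0n subr0.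
have mm0 z : U z -> dot (m z) (m z) != 0.
  by move=> Uz; rewrite gt_eqF// dot_gt0// m1.
have Lab w1 w2 z : U z -> (forall y, U y -> dot ('D_w2 x y) (n y) = 0) ->
    dot ('D_w1 ('D_w2 x) z) (n z) = - dot ('D_w2 x z) ('D_w1 n z).
  move=> Uz h0; have dd : derivable ('D_w2 x) z w1.
    by apply: smooth_derivable Uz; exact: smooth_derive.
  have := derive_near_cst w1 oU Uz h0.
  by rewrite (derive_dot dd (dn w1 z Uz)) => /eqP; rewrite addr_eq0 => /eqP.
have Luu z : U z -> dot ('D_u ('D_u x) z) (n z) = - ('D_u t z * ('D_u t z * q z)).
  by move=> Uz; rewrite (Lab u u z Uz xun) (nu _ Uz) dotZr (xum _ Uz).
have Luv z : U z -> dot ('D_u ('D_v x) z) (n z) = - ('D_u t z * ('D_v t z * q z)).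
  by move=> Uz; rewrite (Lab u v z Uz xvn) (nu _ Uz) dotZr (xvm _ Uz).
have Lvu z : U z -> dot ('D_v ('D_u x) z) (n z) = - ('D_v t z * ('D_u t z * q z)).
  by move=> Uz; rewrite (Lab v u z Uz xun) (nv _ Uz) dotZr (xum _ Uz).
have Lvv z : U z -> dot ('D_v ('D_v x) z) (n z) = - ('D_v t z * ('D_v t z * q z)).
  by move=> Uz; rewrite (Lab v v z Uz xvn) (nv _ Uz) dotZr (xvm _ Uz).
have DD z : U z -> dot ('D_u x z) ('D_u x z) * dot ('D_v x z) ('D_v x z)
    - dot ('D_u x z) ('D_v x z) ^+ 2 = D z ^+ 2.
  by move=> Uz; rewrite -dot_cross_cross (xuvE _ Uz) dotZl dotZr (n1 _ Uz) mulr1 expr2.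
have yy z : U z -> dot (y z) (y z) = 'D_v t z ^+ 2 * dot ('D_u x z) ('D_u x z)
      - 2 * 'D_v t z * 'D_u t z * dot ('D_u x z) ('D_v x z)
      + 'D_u t z ^+ 2 * dot ('D_v x z) ('D_v x z).
  by move=> Uz; rewrite /y (xrul _ Uz); exact: dot_sqB.
have qy z : U z -> q z ^+ 2 * dot (y z) (y z) = D z ^+ 2 * dot (m z) (m z).
  move=> Uz; have := congr1 (fun w => dot w w) (yb z Uz).
  rewrite dotZl dotZr dotZl dotZr (bb _ Uz) => h.
  by rewrite !expr2 -!mulrA h !mulNr mulrN opprK.
have E0 z : U z -> dot (x z) (x z) * dot (m z) (m z) = 2 * (f z * q z).
  move=> Uz; exact: (ruling_identity (D0 z Uz) (mini z Uz) (Luu z Uz) (Luv z Uz)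
    (Lvu z Uz) (Lvv z Uz) (DD z Uz) (yy z Uz) (qy z Uz)).
have dp' w z : U z -> derivable p' z w by exact: smooth_derivable.
have df w z : U z -> derivable f z w by exact: smooth_derivable.
have dxm' w z (Uz : U z) := derivable_dot (dx w z Uz) (dm' w z Uz).
have dq w z : U z -> derivable q z w.
  by move=> Uz; apply: derivableB; [exact: dp'|exact: dxm'].
have qrul z : U z -> 'D_(ruling u v t z) q z = - dot (y z) (m' z).
  move=> Uz; have h := deriveB (dp' (ruling u v t z) z Uz) (dxm' (ruling u v t z) z Uz).
  apply: (etrans h); rewrite (lp' _ Uz) (derive_dot (dx _ z Uz) (dm' _ z Uz)) (lm' _ Uz).
  by rewrite dot0r addr0 sub0r.
(* The derivative of E0 along the ruling, where m and f are constant. *)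
have E1 z : U z -> dot (x z) (y z) * dot (m z) (m z) = - (f z * dot (y z) (m' z)).
  move=> Uz; set w := ruling u v t z.
  have e0 : {near z, (fun z => dot (x z) (x z) * dot (m z) (m z)) =1
                     (fun z => 2 * (f z * q z))}.
    by move/open_nbhs_nbhs: (conj oU Uz); apply: filterS => a Ua; exact: E0.
  have := near_eq_derive w e0.
  have dxx := derivable_dot (dx w z Uz) (dx w z Uz).
  have dmm := derivable_dot (dm w z Uz) (dm w z Uz).
  have dfq := derivable_mul (df w z Uz) (dq w z Uz).
  have d2 : 'D_w (fun z => 2 * (f z * q z)) z = 2 * 'D_w (fun z => f z * q z) z.
    exact: (deriveMl 2 dfq).
  rewrite d2 (derive_mul dxx dmm) (derive_mul (df w z Uz) (dq w z Uz)).
  rewrite (derive_dot (dx w z Uz) (dx w z Uz)) (derive_dot (dm w z Uz) (dm w z Uz)).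
  rewrite (lm _ Uz) (lf _ Uz) (qrul _ Uz) -/(y z) dot0l dot0r (dotC (y z) (x z)).
  move: (dot (x z) (y z)) (dot (m z) (m z)) (f z) (q z) (dot (y z) (m' z)) (dot (x z) (x z)).
  by move=> a c d e g i h; lra.
(* The unnormalised ruling direction y is replaced by its multiple b, which is
   constant along the ruling. *)
have E1' z : U z -> dot (x z) (b z) * dot (m z) (m z) = - (f z * dot (b z) (m' z)).
  move=> Uz; have := congr1 (fun r => q z * r) (E1 z Uz).
  rewrite mulrA -(dotZr (q z)) mulrN mulrCA -(dotZl (q z)) (yb _ Uz) dotZr dotZl.
  apply: cancel_opp_factor; exact: D0.
(* The derivative of E1' along the ruling: only x varies. *)
have yb0 z : U z -> dot (y z) (b z) = 0.
  move=> Uz; set w := ruling u v t z.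
  have e0 : {near z, (fun z => dot (x z) (b z) * dot (m z) (m z)) =1
                     (fun z => - (f z * dot (b z) (m' z)))}.
    by move/open_nbhs_nbhs: (conj oU Uz); apply: filterS => a Ua; exact: E1'.
  have := near_eq_derive w e0.
  have dmm := derivable_dot (dm w z Uz) (dm w z Uz).
  have [db brul] := is_derive_cross (dn w z Uz) (dm w z Uz).
  have dxb := derivable_dot (dx w z Uz) db.
  have dbm := derivable_dot db (dm' w z Uz).
  have dfb := derivable_mul (df w z Uz) dbm.
  rewrite (derive_mul dxb dmm) (deriveN dfb) (derive_mul (df w z Uz) dbm).
  rewrite (derive_dot (dx w z Uz) db) (derive_dot (dm w z Uz) (dm w z Uz)).
  rewrite (derive_dot db (dm' w z Uz)).
  rewrite brul (lm _ Uz) (lm' _ Uz) (lf _ Uz) (ln _ Uz) -/(y z).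
  rewrite !(cross0l, cross0r, addr0, add0r, dot0l, dot0r, mulr0, mul0r, oppr0).
  by move/eqP; rewrite mulf_eq0 (negbTE (mm0 z Uz)) orbF => /eqP.
move=> z Uz; have := congr1 (fun r => q z * r) (yb0 z Uz).
rewrite -dotZl (yb _ Uz) dotZl (bb _ Uz) mulr0 => /eqP.
by rewrite mulf_eq0 oppr_eq0 (negbTE (D0 z Uz)) (negbTE (mm0 z Uz)).
Qed.

End flat_minimal.

(** * Minimal surfaces with degenerate normal are planar *)

Section flat_minimal_normal.
Context {R : realType} {V : normedModType R}.
Context (U : set V) (u v : V) (x n : V -> 'rV[R]_3).
Context (oU : open U) (sx : smooth_on U x) (sn : smooth_on U n).
Context (n1 : forall z, U z -> dot (n z) (n z) = 1)
  (xun : forall z, U z -> dot ('D_u x z) (n z) = 0)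
  (xvn : forall z, U z -> dot ('D_v x z) (n z) = 0)
  (xuv0 : forall z, U z -> cross ('D_u x z) ('D_v x z) != 0)
  (nuv0 : forall z, U z -> cross ('D_u n z) ('D_v n z) = 0)
  (mini : forall z, U z -> minimal_at u v x n z).

Lemma minimal_at_sym z : minimal_at u v x n z -> minimal_at v u x n z.
Proof. by move=> h; exact: (minimal_eq_swap (dotC ('D_u x z) ('D_v x z)) h). Qed.

(** Where a coordinate of n has a non-zero derivative, the surface would be
    developable on a neighbourhood, against minimal_not_developable. *)
Lemma derive_normal_v_eq0 z : U z -> 'D_v n z = 0.
Proof.
move=> Uz; apply/rowP => j; rewrite mxE; apply/eqP/negP => /negP nvj.
have sj : smooth_on U (fun z => 'D_v n z 0 j).
  by apply: smooth_coord => //; exact: smooth_derive.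
have UW : [set z | U z /\ 'D_v n z 0 j != 0] `<=` U by move=> y [].
exact: (@minimal_not_developable R V _ u v x n j (open_neq0 oU sj)
  (smooth_sub UW sx) (smooth_sub UW sn)
  (fun y Uy => n1 (UW y Uy)) (fun y Uy => xun (UW y Uy)) (fun y Uy => xvn (UW y Uy))
  (fun y Uy => xuv0 (UW y Uy)) (fun y Uy => nuv0 (UW y Uy)) (fun y Uy => mini (UW y Uy))
  (fun y Uy => proj2 Uy) z (conj Uz nvj)).
Qed.

End flat_minimal_normal.

Section flat_minimal_plane.
Context {R : realType} {V : normedModType R}.
Context (U : set V) (u v : V) (x n : V -> 'rV[R]_3).
Context (oU : open U) (sx : smooth_on U x) (sn : smooth_on U n).
Context (n1 : forall z, U z -> dot (n z) (n z) = 1)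
  (xun : forall z, U z -> dot ('D_u x z) (n z) = 0)
  (xvn : forall z, U z -> dot ('D_v x z) (n z) = 0)
  (xuv0 : forall z, U z -> cross ('D_u x z) ('D_v x z) != 0)
  (nuv0 : forall z, U z -> cross ('D_u n z) ('D_v n z) = 0)
  (mini : forall z, U z -> minimal_at u v x n z).

Lemma derive_normal_eq0 z : U z -> 'D_u n z = 0 /\ 'D_v n z = 0.
Proof.
move=> Uz; split; last exact: (derive_normal_v_eq0 oU sx sn n1 xun xvn xuv0 nuv0 mini Uz).
have xvu0 y : U y -> cross ('D_v x y) ('D_u x y) != 0.
  by move=> Uy; rewrite crossC oppr_eq0; exact: xuv0.
have nvu0 y : U y -> cross ('D_v n y) ('D_u n y) = 0.
  by move=> Uy; rewrite crossC (nuv0 Uy) oppr0.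
have mini' y (Uy : U y) := minimal_at_sym (mini Uy).
exact: (derive_normal_v_eq0 oU sx sn n1 xvn xun xvu0 nvu0 mini' Uz).
Qed.

(** As dn = 0, the second fundamental form vanishes, so that the trace equation
    leaves only the term in <x,n>. *)
Lemma normal_orth_position z : U z -> dot (x z) (n z) = 0.
Proof.
move=> Uz; have [nu nv] := derive_normal_eq0 Uz; have := mini Uz.
have L w1 w2 : (forall y, U y -> dot ('D_w2 x y) (n y) = 0) -> 'D_w1 n z = 0 ->
    dot ('D_w1 ('D_w2 x) z) (n z) = 0.
  move=> h0 nw.
  have dd : derivable ('D_w2 x) z w1.
    by apply: smooth_derivable Uz; exact: smooth_derive.
  have dn : derivable n z w1 by exact: smooth_derivable sn Uz.
  have := derive_near_cst w1 oU Uz h0.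
  by rewrite (derive_dot dd dn) nw dot0r addr0.
move=> h; have := minimal_eq_flat (L u u xun nu) (L u v xvn nu)
  (L v u xun nv) (L v v xvn nv) h.
by apply; rewrite -dot_cross_cross gt_eqF// dot_gt0// xuv0.
Qed.

End flat_minimal_plane.

(** * The conformal metric and its mean curvature *)

Section conformal_metric.
Context {R : realType}.
Implicit Types (x a b p : 'rV[R]_3).

Lemma enorm_sq n (x : 'rV[R]_n) : enorm x ^- 2 = (dot x x)^-1.
Proof.
rewrite /enorm sqr_sqrtr//; have [->|/dot_gt0/ltW//] := eqVneq x 0.
by rewrite dot0l.
Qed.

Lemma mu2dotE x a b : mu2dot x a b = (dot x x)^-1 * dot a b.
Proof. by rewrite /mu2dot /mu2 mul_mx_scalar enorm_sq -/(dot _ _) dotZl. Qed.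

Lemma derive_mu2 x (i j l : 'I_3) : x != 0 ->
  'D_(evec R i) (fun y => mu2 y j l) x =
  - (2 * x 0 i) / dot x x ^+ 2 * (j == l)%:R.
Proof.
move=> x0; have d0 : dot x x != 0 by rewrite gt_eqF// dot_gt0.
have didx : derivable (id : 'rV[R]_3 -> 'rV[R]_3) x (evec R i) by exact: derivable_id.
have [dd De] : is_derive x (evec R i) (fun y : 'rV[R]_3 => dot y y) (2 * x 0 i).
  apply: is_derive_eq (is_derive_dot didx didx) _.
  by rewrite derive_id (dotC (evec R i)) !dot_evec; ring.
pose h (y : 'rV[R]_3) := (dot y y)^-1.
have dh : derivable h x (evec R i).
  exact: (@derivableV _ _ (fun y : 'rV[R]_3 => dot y y) x (evec R i) d0 dd).
have Dh : 'D_(evec R i) h x = - (2 * x 0 i) / dot x x ^+ 2.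
  apply: (etrans (@deriveV _ _ (fun y : 'rV[R]_3 => dot y y) x (evec R i) d0 dd)).
  rewrite De /GRing.scale /=; field.
  exact: d0.
rewrite -Dh; have := deriveMl (j == l)%:R dh => Dm; rewrite mulrC -Dm.
congr ('D_(evec R i) _ x); apply/funext => y.
by rewrite /= /mu2 mxE enorm_sq mulr_natl.
Qed.

(** The conformal factor is exp(2 phi) with phi = - ln |x|, of gradient
    - x / |x|^2; these are the usual Christoffel symbols of a conformal metric. *)
Lemma christoffelE x (k i j : 'I_3) : x != 0 ->
  christoffel x k i j =
  - (dot x x)^-1 * (x 0 i * (j == k)%:R + x 0 j * (i == k)%:R - x 0 k * (i == j)%:R).
Proof.
move=> x0; have d0 : dot x x != 0 by rewrite gt_eqF// dot_gt0.
rewrite /christoffel.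
under eq_bigr => l _ do rewrite !derive_mu2//.
have -> : invmx (mu2 x) = (dot x x)%:M.
  by rewrite /mu2 invmx_scalar enorm_sq invrK.
rewrite (bigD1 k) //= big1 ?addr0; last first.
  by move=> l lk; rewrite mxE eq_sym (negbTE lk) mulr0n mul0r.
rewrite mxE eqxx mulr1n; field.
exact: d0.
Qed.

Lemma christoffel_sum x a b : x != 0 ->
  \row_(k < 3) (\sum_(i < 3) \sum_(j < 3) christoffel x k i j * a 0 i * b 0 j) =
  - (dot x x)^-1 *: (dot x a *: b + dot x b *: a - dot a b *: x).
Proof.
move=> x0; apply/rowP => k; rewrite !mxE.
transitivity (- (dot x x)^-1 * \sum_(i < 3) \sum_(j < 3)
   (x 0 i * (j == k)%:R + x 0 j * (i == k)%:R - x 0 k * (i == j)%:R) * a 0 i * b 0 j).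
  rewrite mulr_sumr; apply: eq_bigr => i _; rewrite mulr_sumr; apply: eq_bigr => j _.
  by rewrite christoffelE// !mulrA.
congr (_ * _).
transitivity (\sum_(i < 3) (x 0 i * a 0 i * b 0 k + (i == k)%:R * a 0 i * dot x b
   - x 0 k * (a 0 i * b 0 i))).
  apply: eq_bigr => i _.
  transitivity (\sum_(j < 3) (x 0 i * a 0 i * ((j == k)%:R * b 0 j) +
     (i == k)%:R * a 0 i * (x 0 j * b 0 j) - x 0 k * a 0 i * ((i == j)%:R * b 0 j))).
    by apply: eq_bigr => j _; ring.
  have pick (m : 'I_3) : \sum_(j < 3) ((j == m)%:R * b 0 j) = b 0 m.
    rewrite (bigD1 m)//= eqxx mul1r big1 ?addr0// => j jm.
    by rewrite (negbTE jm) mul0r.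
  rewrite sumrB big_split /= -!mulr_sumr pick.
  under [X in _ - _ * X]eq_bigr => j _ do rewrite eq_sym.
  rewrite pick /dot mxE.
  under [X in _ = _ + _ * X - _]eq_bigr => j _ do rewrite mxE.
  by rewrite mulrA.
rewrite sumrB big_split /= -!mulr_suml -mulr_sumr.
have dotE (u v : 'rV[R]_3) : dot u v = \sum_(i < 3) u 0 i * v 0 i.
  by rewrite /dot mxE; apply: eq_bigr => i _; rewrite mxE.
have -> : \sum_(i < 3) (i == k)%:R * a 0 i = a 0 k.
  rewrite (bigD1 k)//= eqxx mul1r big1 ?addr0// => j jk.
  by rewrite (negbTE jk) mul0r.
by rewrite -!dotE; ring.
Qed.

End conformal_metric.

Section conformal_trace.
Context {R : realType}.

(** Only the last term of the correction to the second derivative has a normal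
    component: this is the origin of the term in <x,n> of the minimal surface
    equation. *)
Lemma cov_dot (w a b y n : 'rV[R]_3) (k p q r : R) : dot a n = 0 -> dot b n = 0 ->
  dot (w + - k *: (p *: b + q *: a - r *: y)) n = dot w n + k * (r * dot y n).
Proof.
move=> an bn; rewrite dotDl dotZl dotDl dotNl dotDl !dotZl an bn; ring.
Qed.

(** The left factor is replaced by the adjugate matrix, to avoid denominators. *)
Lemma trace_inv2 (A B : 'M[R]_2) :
  A 0 0 * A 1 1 - A 0 1 * A 1 0 != 0 -> \tr (invmx A *m B) = 0 ->
  A 1 1 * B 0 0 - A 0 1 * B 1 0 - A 1 0 * B 0 1 + A 0 0 * B 1 1 = 0.
Proof.
set d := _ - _ => d0.
pose C : 'M[R]_2 := \matrix_(i, j)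
  (if i == 0 then (if j == 0 then A 1 1 else - A 0 1)
   else (if j == 0 then - A 1 0 else A 0 0)).
have AC : A *m C = d%:M.
  apply/matrixP => i j; rewrite !mxE !big_ord_recl big_ord0 !mxE /=.
  have -> : lift ord0 ord0 = 1 :> 'I_2 by apply/val_inj.
  by case: (ord2P i) => ->; case: (ord2P j) => -> /=; rewrite ?mulr1n ?mulr0n /d; ring.
have uA : A \in unitmx.
  have := mulmx1_unit (A := A) (B := d^-1 *: C).
  by case=> //; rewrite -scalemxAr AC scale_scalar_mx mulVf.
have -> : invmx A = d^-1 *: C.
  by rewrite -[RHS](mulKmx uA) -scalemxAr AC scale_scalar_mx mulVf// mulmx1.
rewrite -scalemxAl mxtraceZ => /eqP; rewrite mulf_eq0 invr_eq0 (negbTE d0) /= => /eqP <-.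
rewrite /mxtrace !big_ord_recl big_ord0 !mxE !big_ord_recl !big_ord0 !mxE /=.
have -> : lift ord0 ord0 = 1 :> 'I_2 by apply/val_inj.
ring.
Qed.

Lemma det_conformal (E F G xx : R) : 0 < xx -> 0 < E * G - F ^+ 2 ->
  (xx^-1 * E) * (xx^-1 * G) - (xx^-1 * F) * (xx^-1 * F) != 0.
Proof.
move=> x0 d0; rewrite (_ : _ - _ = xx^-1 ^+ 2 * (E * G - F ^+ 2)); last by ring.
by rewrite mulf_neq0 ?expf_neq0 ?invr_neq0// gt_eqF.
Qed.

(** A and B are the first and second fundamental forms of the conformal metric,
    L is the Euclidean second fundamental form. *)
Lemma trace_conformal (A B L : 'M[R]_2) (E F G xx k f : R) : 0 < xx -> 0 < k ->
  0 < E * G - F ^+ 2 ->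
  A 0 0 = xx^-1 * E -> A 0 1 = xx^-1 * F -> A 1 0 = xx^-1 * F -> A 1 1 = xx^-1 * G ->
  (forall a b, B a b = xx^-1 * k * (L a b + A a b * f)) ->
  \tr (invmx A *m B) = 0 ->
  (G * L 0 0 - F * (L 0 1 + L 1 0) + E * L 1 1) * xx + 2 * f * (E * G - F ^+ 2) = 0.
Proof.
move=> x0 k0 d0 A00 A01 A10 A11 BE trB; have xx0 : xx != 0 by rewrite gt_eqF.
have dA : A 0 0 * A 1 1 - A 0 1 * A 1 0 != 0.
  by rewrite A00 A01 A10 A11; exact: det_conformal.
have := trace_inv2 dA trB; rewrite !BE A00 A01 A10 A11 => h.
apply: (mulfI (x := xx^-1 ^+ 3 * k)).
  by rewrite mulf_neq0 ?expf_neq0 ?invr_neq0// gt_eqF.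
by rewrite mulr0 -[RHS]h; field.
Qed.

End conformal_trace.

(** * The surface read in a chart *)

Section chart_geometry.
Context {R : realType} {S : topologicalType} (c : chart R S) (X : S -> S2xR R).
Local Notation x := (local_rep c X).
Local Notation u := (evec R (0 : 'I_2)).
Local Notation v := (evec R (1 : 'I_2)).

(** The unit normal for the Euclidean metric; its coordinates are those of the
    unit normal of the conformal metric in the frame |x| d/dx_j (normal_coordE). *)
Definition euclid_normal (z : 'rV[R]_2) : 'rV[R]_3 :=
  let nu := cross ('D_u x z) ('D_v x z) in (Num.sqrt (dot nu nu))^-1 *: nu.

Lemma to_model_neq0 (q : S2xR R) : to_model q != 0.
Proof.
apply/eqP => /(congr1 (fun w => dot w w)); rewrite /to_model dotZl dotZr (svalP q.1).
by rewrite dot0l mulr1 => /eqP; rewrite mulf_eq0 gt_eqF ?expR_gt0.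
Qed.

Lemma local_rep_neq0 z : x z != 0.
Proof. exact: to_model_neq0. Qed.

Lemma local_rep_sq_gt0 z : 0 < dot (x z) (x z).
Proof. by rewrite dot_gt0// local_rep_neq0. Qed.

(** If the cross product vanished, G u - F v would be in the kernel of the
    differential, where G = <x_v,x_v> and F = <x_u,x_v>: this is the orthogonal
    projection of x_u on the complement of x_v, up to the factor G. *)
Lemma cross_partial_neq0 z : differentiable x z -> injective ('d x z) ->
  cross ('D_u x z) ('D_v x z) != 0.
Proof.
move=> dx injx; apply/eqP => /(congr1 (fun w => dot w w)).
rewrite dot_cross_cross dot0l (deriveE u dx) (deriveE v dx).
have [v0|/dot_gt0 vv0] := eqVneq ('d x z v) 0.
  have /rowP/(_ 1) := injx v 0 (etrans v0 (esym (linear0 ('d x z)))).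
  by rewrite !mxE /= => /eqP; rewrite oner_eq0.
move=> h; pose G := dot ('d x z v) ('d x z v); pose F := dot ('d x z u) ('d x z v).
(* Its square norm is G (E G - F^2) = 0. *)
have w0 : 'd x z (G *: u - F *: v) = 0.
  rewrite linearB !linearZ /=; apply: contrapT => /eqP/dot_gt0.
  rewrite scalerN dot_sqB -/F -/G.
  rewrite [X in 0 < X](_ : _ = G * (dot ('d x z u) ('d x z u) * G - F ^+ 2)).
    by rewrite h mulr0 ltxx.
  by ring.
have /rowP/(_ 0) := injx _ 0 (etrans w0 (esym (linear0 ('d x z)))).
rewrite !mxE /= mulr1 mulr0 subr0 => G0.
by move: vv0; rewrite -/G G0 ltxx.
Qed.

Context (oU : open (cimg c)) (sx : smooth_on (cimg c) x)
  (injx : forall z, cimg c z -> injective ('d x z)).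

Let xuv0 z : cimg c z -> cross ('D_u x z) ('D_v x z) != 0.
Proof.
by move=> Uz; apply: cross_partial_neq0 (injx Uz); exact: smooth_differentiable sx Uz.
Qed.

Lemma smooth_euclid_normal : smooth_on (cimg c) euclid_normal.
Proof.
have snu : smooth_on (cimg c) (fun z => cross ('D_u x z) ('D_v x z)).
  by apply: smooth_cross => //; exact: smooth_derive.
have sd := smooth_dot oU snu snu.
have d0 z (Uz : cimg c z) := dot_gt0 (xuv0 Uz).
apply: smoothZ => //; apply: smoothV => //; last exact: smooth_sqrt.
by move=> z Uz; rewrite gt_eqF// sqrtr_gt0 d0.
Qed.

Lemma euclid_normal1 z : cimg c z -> dot (euclid_normal z) (euclid_normal z) = 1.
Proof.
move=> Uz; have d0 := dot_gt0 (xuv0 Uz).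
rewrite /euclid_normal dotZl dotZr mulrA -invfM -expr2 sqr_sqrtr ?ltW//.
by rewrite mulVf// gt_eqF.
Qed.

Lemma euclid_normal_u z : dot ('D_u x z) (euclid_normal z) = 0.
Proof. by rewrite /euclid_normal dotZr dot_cross_l mulr0. Qed.

Lemma euclid_normal_v z : dot ('D_v x z) (euclid_normal z) = 0.
Proof. by rewrite /euclid_normal dotZr dot_cross_r mulr0. Qed.

Lemma unit_normalE z : unit_normal c X z = enorm (x z) *: euclid_normal z.
Proof.
rewrite /unit_normal /partial1 inord2_0 inord2_1 /euclid_normal scalerA mu2dotE.
have xx := local_rep_sq_gt0 z.
by rewrite sqrtrM ?invr_ge0 ?ltW// sqrtrV ?ltW// invfM invrK.
Qed.

Lemma enorm_gt0 z : 0 < enorm (x z).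
Proof. by rewrite sqrtr_gt0 local_rep_sq_gt0. Qed.

Lemma normal_coordE z j : normal_coord c X z j = euclid_normal z 0 j.
Proof.
rewrite /normal_coord mu2dotE unit_normalE /frameE dotZl dotZr dot_evec.
rewrite -enorm_sq; have := enorm_gt0 z; move: (enorm _) => e e0; field.
by rewrite gt_eqF.
Qed.

Lemma mean_curvature_minimal_at z : cimg c z -> mean_curvature c X z = 0 ->
  minimal_at u v x euclid_normal z.
Proof.
move=> Uz; rewrite /mean_curvature => /eqP.
rewrite mulf_eq0 invr_eq0 pnatr_eq0 /= => /eqP.
have xx := local_rep_sq_gt0 z; have e0 := enorm_gt0 z.
have EG := dot_gt0 (xuv0 Uz); rewrite dot_cross_cross in EG.
have perp a : dot ('D_(evec R a) x z) (euclid_normal z) = 0.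
  case: a => [[|[|//]] h].
    rewrite (_ : Ordinal h = 0) ?euclid_normal_u//; exact/val_inj.
  rewrite (_ : Ordinal h = 1) ?euclid_normal_v//; exact/val_inj.
have IE a b : first_form c X z a b =
    (dot (x z) (x z))^-1 * dot ('D_(evec R a) x z) ('D_(evec R b) x z).
  by rewrite mxE mu2dotE.
pose L : 'M[R]_2 := \matrix_(a, b) dot ('D_(evec R a) ('D_(evec R b) x) z) (euclid_normal z).
have IIE a b : second_form c X z a b = (dot (x z) (x z))^-1 * enorm (x z) *
    (L a b + first_form c X z a b * dot (x z) (euclid_normal z)).
  rewrite [LHS]mxE mu2dotE unit_normalE dotZr mulrA; congr (_ * _).
  rewrite /cov_deriv (christoffel_sum _ _ (local_rep_neq0 z)).
  apply: (etrans (cov_dot _ _ _ _ _ _ (perp a) (perp b))).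
  congr (_ + _); first by rewrite [RHS]mxE.
  by apply: (etrans (mulrA _ _ _)); rewrite (IE a b).
have IE10 : first_form c X z 1 0 = (dot (x z) (x z))^-1 * dot ('D_u x z) ('D_v x z).
  exact: (etrans (IE 1 0) (congr1 _ (dotC ('D_v x z) ('D_u x z)))).
move=> h; have := trace_conformal xx e0 EG (IE 0 0) (IE 0 1) IE10 (IE 1 1) IIE h.
by rewrite !mxE.
Qed.

End chart_geometry.

(** * Stereographic projection of the normal *)

Section gauss_map.
Context {R : realType}.
Implicit Types (n : 'rV[R]_3).

Local Open Scope complex_scope.

(** Stereographic projection from the south pole of a unit vector. *)
Definition stereo n : option R[i] :=
  if 1 + n 0 (inord 2) == 0 then None
  else Some ((n 0 (inord 0) +i* n 0 (inord 1)) / (1 + n 0 (inord 2))%:C).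

Lemma chart_gauss_mapE (S : topologicalType) (c : chart R S) (X : S -> S2xR R) z :
  chart_gauss_map c X z = stereo (euclid_normal c X z).
Proof. by rewrite /chart_gauss_map !normal_coordE. Qed.

Lemma complex_invE (a b : R) :
  (a +i* b)^-1 = (a / (a ^+ 2 + b ^+ 2)) -i* (b / (a ^+ 2 + b ^+ 2)).
Proof. by []. Qed.

Lemma complex_mulE (a b d e : R) :
  (a +i* b) * (d +i* e) = (a * d - b * e) +i* (a * e + b * d).
Proof. by []. Qed.

Lemma complex_divr (a b r : R) : (a +i* b) / r%:C = (a / r) +i* (b / r).
Proof.
have -> : r%:C^-1 = r^-1 +i* 0.
  rewrite complex_invE expr0n addr0 mul0r oppr0; congr (_ +i* _).
  by have [->|r0] := eqVneq r 0; [rewrite invr0 mul0r|field].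
by rewrite complex_mulE !mulr0 subr0 add0r.
Qed.

Lemma stereoE n : 1 + n 0 (inord 2) != 0 -> stereo n =
  Some ((n 0 (inord 0) / (1 + n 0 (inord 2))) +i* (n 0 (inord 1) / (1 + n 0 (inord 2)))).
Proof. by move=> h; rewrite /stereo (negbTE h) complex_divr. Qed.

Lemma dot1_pole n : dot n n = 1 -> 1 + n 0 (inord 2) = 0 ->
  n 0 (inord 0) = 0 /\ n 0 (inord 1) = 0.
Proof.
rewrite dot3E => n1 /eqP; rewrite addrC addr_eq0 => /eqP n2.
move: n1; rewrite n2 mulrNN mulr1 => /eqP; rewrite -subr_eq0 addrK.
rewrite -!expr2 paddr_eq0 ?sqr_ge0// !sqrf_eq0 => /andP[/eqP -> /eqP ->].
by [].
Qed.

(** The third coordinate is recovered from |w|^2 + 1 = 2 / (1 + n_3), where w is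
    the projection of n, and then the other two from w. *)
Lemma stereo_inj n n' : dot n n = 1 -> dot n' n' = 1 -> stereo n = stereo n' -> n = n'.
Proof.
move=> n1 n1'; have [p|p] := eqVneq (1 + n 0 (inord 2)) 0.
  have [p'|p'] := eqVneq (1 + n' 0 (inord 2)) 0; last first.
    by rewrite (stereoE p') /stereo p eqxx.
  have [a0 a1] := dot1_pole n1 p; have [b0 b1] := dot1_pole n1' p'.
  move=> _; apply: rowv3P; rewrite ?a0 ?b0 ?a1 ?b1//.
  by apply: (addrI 1); rewrite p p'.
rewrite (stereoE p); have [p'|p'] := eqVneq (1 + n' 0 (inord 2)) 0.
  by rewrite /stereo p' eqxx.
rewrite (stereoE p') => -[].
move: n1 n1'; rewrite !dot3E => n1 n1' e0 e1.
have norm (a b d : R) : 1 + d != 0 -> a * a + b * b + d * d = 1 ->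
    1 + (a / (1 + d)) ^+ 2 + (b / (1 + d)) ^+ 2 = 2 / (1 + d).
  move=> d0 h.
  rewrite (_ : 2 / (1 + d) = (1 + 2 * d + (a * a + b * b + d * d)) / (1 + d) ^+ 2).
    by field.
  by rewrite h; field.
have e2 : 1 + n 0 (inord 2) = 1 + n' 0 (inord 2).
  apply: invr_inj; apply: (mulfI (x := 2)); first by rewrite pnatr_eq0.
  by rewrite -(norm _ _ _ p n1) -(norm _ _ _ p' n1') e0 e1.
apply: rowv3P.
- by rewrite -(divfK p (n 0 _)) e0 e2 divfK.
- by rewrite -(divfK p (n 0 _)) e1 e2 divfK.
- exact: addrI e2.
Qed.

Lemma sphere_chart0_stereo n : 1 + n 0 (inord 2) != 0 ->
  sphere_chart0 (stereo n) =
  (1 + n 0 (inord 2))^-1 *: (n 0 (inord 0) *: evec R 0 + n 0 (inord 1) *: evec R 1).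
Proof.
move=> p; rewrite (stereoE p) /= inord2_0 inord2_1 scalerDr !scalerA.
by rewrite !(mulrC _^-1).
Qed.

(** The inverse of stereographic projection from one pole is the conjugate of the
    projection from the other pole. At the south pole, both sides are 0. *)
Lemma sphere_chart_oo_stereo n : dot n n = 1 -> 1 - n 0 (inord 2) != 0 ->
  sphere_chart_oo (stereo n) =
  (1 - n 0 (inord 2))^-1 *: (n 0 (inord 0) *: evec R 0 - n 0 (inord 1) *: evec R 1).
Proof.
move=> n1 q; have [p|p] := eqVneq (1 + n 0 (inord 2)) 0.
  have [-> ->] := dot1_pole n1 p.
  by rewrite /stereo p eqxx /= !scale0r subr0 scaler0.
rewrite (stereoE p) /sphere_chart_oo complex_invE /vec_of_complex inord2_0 inord2_1.
rewrite scalerDr scalerN !scalerA -scaleNr; move: n1; rewrite dot3E.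
move: (n 0 (inord 0)) (n 0 (inord 1)) (n 0 (inord 2)) p q => a b d p q n1.
have ab : (a / (1 + d)) ^+ 2 + (b / (1 + d)) ^+ 2 = (1 - d) / (1 + d).
  transitivity ((a * a + b * b + d * d - d ^+ 2) / (1 + d) ^+ 2); first by field.
  by rewrite n1; field.
by rewrite ab; congr (_ *: _ + _ *: _); field; rewrite p q.
Qed.

End gauss_map.

(** * Singular projections have a degenerate normal *)

Section singular_gauss_map.
Context {R : realType}.
Local Notation V := 'rV[R]_2.
Local Notation u := (evec R (0 : 'I_2)).
Local Notation v := (evec R (1 : 'I_2)).

(** Contraposition turns a non-bijective differential into a vanishing Jacobian
    determinant. *)
Lemma diff_bijective (G : V -> V) (z : V) : differentiable G z ->
  'D_u G z 0 0 * 'D_v G z 0 1 - 'D_u G z 0 1 * 'D_v G z 0 0 != 0 ->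
  bijective ('d G z).
Proof.
move=> dG; have dE w : 'd G z w = w 0 0 *: 'D_u G z + w 0 1 *: 'D_v G z.
  by rewrite -derive_row2// deriveE.
move: ('D_u G z) ('D_v G z) dE => a b dE; set d := _ - _ => d0.
exists (fun w : V => ((w 0 0 * b 0 1 - w 0 1 * b 0 0) / d) *: u +
                 ((w 0 1 * a 0 0 - w 0 0 * a 0 1) / d) *: v) => w.
  rewrite dE [RHS]row2_evec !mxE.
  by congr (_ *: _ + _ *: _); rewrite /d; field.
rewrite dE !mxE /= !(mulr0, mulr1, addr0, add0r).
apply/rowP => i; case: (ord2P i) => ->; rewrite !mxE; rewrite /d; field; exact: d0.
Qed.

(** The cross product of the derivatives nu, nv of the unit normal n is c n, and
    the Jacobian determinant of the projection (g1, g2) is c / p^2. *)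
Lemma projection_jacobian_algebra (s p g1 g2 g1u g2u g1v g2v : R) (n nu nv : 'rV[R]_3) :
  let n1 := n 0 (inord 0) in let n2 := n 0 (inord 1) in let n3 := n 0 (inord 2) in
  s ^+ 2 = 1 -> p != 0 -> p = 1 + s * n3 ->
  dot n n = 1 -> dot nu n = 0 -> dot nv n = 0 ->
  n1 = g1 * p -> s * n2 = g2 * p ->
  nu 0 (inord 0) = g1u * p + g1 * (s * nu 0 (inord 2)) ->
  nv 0 (inord 0) = g1v * p + g1 * (s * nv 0 (inord 2)) ->
  s * nu 0 (inord 1) = g2u * p + g2 * (s * nu 0 (inord 2)) ->
  s * nv 0 (inord 1) = g2v * p + g2 * (s * nv 0 (inord 2)) ->
  g1u * g2v - g2u * g1v = 0 -> cross nu nv = 0.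
Proof.
move=> n1 n2 n3 s1 p0 pE nn nun nvn e1 e2 e1u e1v e2u e2v g0.
have C := cross_orth nn nun nvn; move: (dot _ n) C => c C.
have C0 : _ = c * n1 := etrans (esym (cross0E nu nv)) ltac:(by rewrite C mxE).
have C1 : _ = c * n2 := etrans (esym (cross1E nu nv)) ltac:(by rewrite C mxE).
have C2 : _ = c * n3 := etrans (esym (cross2E nu nv)) ltac:(by rewrite C mxE).
(* The determinant is a combination of the minors of (nu, nv), which are the
   coordinates of c n; the sum is c times a factor that |n| = 1 makes equal to 1. *)
suff c0 : c = 0 by rewrite C c0 scale0r.
have : p ^+ 2 * (g1u * g2v - g2u * g1v) = s * (c * n3 + g2 * (c * n2) + s * (g1 * (c * n1))).
  rewrite -C0 -C1 -C2.
  transitivity ((g1u * p) * (g2v * p) - (g2u * p) * (g1v * p)); first by ring.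
  have -> : g1u * p = nu 0 (inord 0) - g1 * (s * nu 0 (inord 2)) by rewrite e1u addrK.
  have -> : g1v * p = nv 0 (inord 0) - g1 * (s * nv 0 (inord 2)) by rewrite e1v addrK.
  have -> : g2u * p = s * nu 0 (inord 1) - g2 * (s * nu 0 (inord 2)) by rewrite e2u addrK.
  have -> : g2v * p = s * nv 0 (inord 1) - g2 * (s * nv 0 (inord 2)) by rewrite e2v addrK.
  ring.
rewrite g0 mulr0 => h.
rewrite dot3E -/n1 -/n2 -/n3 in nn.
have h2 : p * (s * (n3 + g2 * n2 + s * (g1 * n1))) = p.
  transitivity (s * (p * n3 + (g2 * p) * n2 + s * ((g1 * p) * n1))); first by ring.
  rewrite -e2 -e1.
  transitivity (s * p * n3 + s ^+ 2 * (n1 * n1 + n2 * n2 + n3 * n3 - n3 * n3)); first by ring.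
  rewrite nn s1 pE; transitivity (1 + s * n3 + (s ^+ 2 - 1) * n3 ^+ 2); first by ring.
  by rewrite s1 subrr mul0r addr0.
have h3 := mulfI p0 (etrans h2 (esym (mulr1 p))).
rewrite -[c]mulr1 -h3 [RHS]h; ring.
Qed.

(** The sign s is 1 for the projection from the south pole, and -1 for the
    conjugate of the projection from the north pole, so that both charts of the
    Riemann sphere are covered. *)
Lemma projection_jacobian_eq0 (U : set V) (n : V -> 'rV[R]_3) (s : R) (G : V -> V) (z : V) :
  open U -> U z -> smooth_on U n -> s ^+ 2 = 1 ->
  (forall y, U y -> dot (n y) (n y) = 1) ->
  (forall y, U y -> 1 + s * n y 0 (inord 2) != 0) ->
  (forall y, U y -> G y = (1 + s * n y 0 (inord 2))^-1 *:
     (n y 0 (inord 0) *: u + (s * n y 0 (inord 1)) *: v)) ->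
  ~ bijective ('d G z) -> cross ('D_u n z) ('D_v n z) = 0.
Proof.
move=> oU Uz sn s1 n1 p0 GE nbij.
pose p y := 1 + s * n y 0 (inord 2).
have sni i : smooth_on U (fun y => n y 0 i) by exact: smooth_coord.
have scn k i : smooth_on U (fun y => k * n y 0 i).
  exact: (smoothM oU (smooth_cst U k) (sni i)).
have sp : smooth_on U p by exact: (smoothD oU (smooth_cst U (1 : R)) (scn s (inord 2))).
have sV := smoothV oU p0 sp.
have G0 y : U y -> G y 0 0 = (p y)^-1 * n y 0 (inord 0).
  by move=> Uy; rewrite GE// !mxE /= !(mulr0, mulr1, addr0).
have G1 y : U y -> G y 0 1 = (p y)^-1 * (s * n y 0 (inord 1)).
  by move=> Uy; rewrite GE// !mxE /= !(mulr0, mulr1, add0r).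
have sG : smooth_on U G.
  apply: smooth_row => // i; case: (ord2P i) => ->.
    apply: (smooth_eq oU (fun y Uy => esym (G0 y Uy))); exact: smoothM.
  apply: (smooth_eq oU (fun y Uy => esym (G1 y Uy))); exact: smoothM.
have dG := smooth_differentiable sG Uz.
have dn w : derivable n z w by exact: smooth_derivable sn Uz.
have dni w i := @derivable_coord _ _ _ n z w i (dn w).
have dGw w : derivable G z w by exact: smooth_derivable sG Uz.
have dGi w i := @derivable_coord _ _ _ G z w i (dGw w).
have dp w : derivable p z w by exact: smooth_derivable sp Uz.
have Dsn w i : 'D_w (fun y => s * n y 0 i) z = s * 'D_w n z 0 i.
  by apply: (etrans (deriveMl s (dni w i))); rewrite -(derive_coord i (dn w)).
have Dp w : 'D_w p z = s * 'D_w n z 0 (inord 2).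
  have dsn : derivable (fun y => s * n y 0 (inord 2)) z w.
    exact: smooth_derivable (scn s (inord 2)) Uz.
  apply: (etrans (deriveD (@derivable_cst R V R 1 z w) dsn)).
  by rewrite derive_cst add0r Dsn.
have prod i (f : V -> R) w : (forall y, U y -> f y = G y 0 i * p y) ->
    'D_w f z = 'D_w G z 0 i * p z + G z 0 i * (s * 'D_w n z 0 (inord 2)).
  move=> fE; rewrite -Dp (derive_coord i (dGw w)).
  rewrite -(derive_mul (dGi w i) (dp w)); apply: near_eq_derive.
  by move/open_nbhs_nbhs: (conj oU Uz); apply: filterS.
have e1 y : U y -> n y 0 (inord 0) = G y 0 0 * p y.
  by move=> Uy; rewrite G0// mulrAC mulVf ?mul1r// p0.
have e2 y : U y -> s * n y 0 (inord 1) = G y 0 1 * p y.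
  by move=> Uy; rewrite G1// mulrAC mulVf ?mul1r// p0.
have nn w : dot ('D_w n z) (n z) = 0.
  have := derive_near_cst w oU Uz n1.
  rewrite (derive_dot (dn w) (dn w)) (dotC (n z)) => /eqP.
  by rewrite -mulr2n mulrn_eq0 /= => /eqP.
have g0 : 'D_u G z 0 0 * 'D_v G z 0 1 - 'D_u G z 0 1 * 'D_v G z 0 0 = 0.
  by apply: contrapT => /eqP/(diff_bijective dG).
have f1 w := etrans (derive_coord (inord 0) (dn w)) (prod 0 _ w e1).
have f2 w := etrans (esym (Dsn w (inord 1))) (prod 1 _ w e2).
exact: (projection_jacobian_algebra s1 (p0 z Uz) erefl (n1 z Uz) (nn u) (nn v)
  (e1 z Uz) (e2 z Uz) (f1 u) (f1 v) (f2 u) (f2 v) g0).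
Qed.

End singular_gauss_map.

(** * Singular minimal surfaces *)

Section singular_minimal_surface.
Context {R : realType} {S : topologicalType} (M : oriented_riemannian_surface R S).
Context (X : S -> S2xR R) (g : S -> option (complex R)).
Context (immX : conformal_immersion M X) (minX : minimal M X).
Context (gX : is_gauss_map M X g) (sing : singular_map M g).
Local Notation u := (evec R (0 : 'I_2)).
Local Notation v := (evec R (1 : 'I_2)).

Section in_chart.
Context (c : chart R S) (Mc : atlas M c).
Local Notation x := (local_rep c X).
Local Notation n := (euclid_normal c X).

Let oU : open (cimg c). Proof. by have [] := atlas_chart Mc. Qed.

Let sx : smooth_on (cimg c) x. Proof. by have [h _] := immX; have [] := h c Mc. Qed.

Let injx z : cimg c z -> injective ('d x z).
Proof. by have [h _] := immX; have [_] := h c Mc; apply. Qed.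

Let sn : smooth_on (cimg c) n. Proof. exact: smooth_euclid_normal. Qed.

Let n1 z : cimg c z -> dot (n z) (n z) = 1.
Proof. exact: (euclid_normal1 sx injx). Qed.

Lemma gauss_map_chart p : cdom c p -> g p = stereo (n (cmap c p)).
Proof. by move=> cp; rewrite (gX Mc cp) chart_gauss_mapE. Qed.

Lemma gauss_map_cinv z : cimg c z -> g (cinv c z) = stereo (n z).
Proof.
have [_ _ cK _ _] := atlas_chart Mc.
by move=> [p cp <-]; rewrite (cK p cp); exact: gauss_map_chart cp.
Qed.

(** Away from the south pole the chart of the Riemann sphere around 0 is used, and
    at the south pole the chart around infinity. *)
Lemma gauss_map_degenerate z : cimg c z -> cross ('D_u n z) ('D_v n z) = 0.
Proof.
move=> Uz; have [p cp pz] := Uz; have [sing0 singoo] := sing Mc cp.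
have gp : g p = stereo (n z) by rewrite -pz; exact: gauss_map_chart cp.
have sni : smooth_on (cimg c) (fun y => n y 0 (inord 2)) by exact: smooth_coord.
have pole s : open [set y | cimg c y /\ 1 + s * n y 0 (inord 2) != 0].
  apply: (open_neq0 oU).
  exact: (smoothD oU (smooth_cst _ (1 : R)) (smoothM oU (smooth_cst _ (s : R)) sni)).
have sub s : [set y | cimg c y /\ 1 + s * n y 0 (inord 2) != 0] `<=` cimg c.
  by move=> y [].
have [q|q] := eqVneq (1 + n z 0 (inord 2)) 0.
- have z3 : n z 0 (inord 2) = - 1.
    by apply/eqP; rewrite -addr_eq0 addrC q.
  apply: (@projection_jacobian_eq0 R _ n (-1)
    (@sphere_chart_oo R \o g \o cinv c) z (pole (-1))).
  + by split=> //; rewrite z3 mulrNN mulr1; apply/negbT; exact: (pnatr_eq0 R 2).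
  + exact: smooth_sub (sub (-1)) sn.
  + by rewrite sqrrN expr1n.
  + by move=> y [Uy _]; exact: n1.
  + by move=> y [].
  + move=> y [Uy]; rewrite !mulN1r => y3 /=.
    rewrite (gauss_map_cinv Uy) (sphere_chart_oo_stereo (n1 Uy) y3) scaleNr; reflexivity.
  + by rewrite -pz; apply: singoo; rewrite gp /stereo q eqxx.
- apply: (@projection_jacobian_eq0 R _ n 1 (@sphere_chart0 R \o g \o cinv c) z (pole 1)).
  + by split=> //; rewrite mul1r.
  + exact: smooth_sub (sub 1) sn.
  + by rewrite expr1n.
  + by move=> y [Uy _]; exact: n1.
  + by move=> y [].
  + move=> y [Uy]; rewrite !mul1r => y3 /=.
    rewrite (gauss_map_cinv Uy) (sphere_chart0_stereo y3); reflexivity.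
  + by rewrite -pz; apply: sing0; rewrite gp (stereoE q).
Qed.

Let xun z (_ : cimg c z) := euclid_normal_u c X z.
Let xvn z (_ : cimg c z) := euclid_normal_v c X z.
Let xuv0 z (Uz : cimg c z) :=
  cross_partial_neq0 (smooth_differentiable sx Uz) (injx Uz).
Let mini z (Uz : cimg c z) := mean_curvature_minimal_at sx injx Uz (minX Mc Uz).

Lemma normal_orth z : cimg c z -> dot (x z) (n z) = 0.
Proof. exact: (normal_orth_position oU sx sn n1 xun xvn xuv0 gauss_map_degenerate mini). Qed.

Lemma gauss_map_locally_cst p : cdom c p -> \forall q \near p, g q = g p.
Proof.
move=> cp; have [od _ _ cc _] := atlas_chart Mc.
have Uz : cimg c (cmap c p) by exists p.
have /nbhs_ballP[r /= r0 rU] := open_nbhs_nbhs (conj oU Uz).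
have nc y : ball (cmap c p) r y -> n y = n (cmap c p).
  move=> yr; apply/rowP => i.
  apply: (@derive_eq0_ball R _ (fun y => n y 0 i) (cmap c p) y r) => // a ar.
  have Ua := rU a ar; have dn := smooth_differentiable sn Ua.
  split; first exact: smooth_differentiable (smooth_coord i oU sn) Ua.
  move=> w; have dnw : derivable n a w by exact: smooth_derivable sn Ua.
  rewrite -(derive_coord i dnw) (derive_row2 w dn).
  have [-> ->] := derive_normal_eq0 oU sx sn n1 xun xvn xuv0 gauss_map_degenerate mini Ua.
  by rewrite !scaler0 addr0 mxE.
have nb : \forall q \near p, ball (cmap c p) r (cmap c q).
  by apply: (cc p cp); exact: nbhsx_ballx.
apply: filterS2 (open_nbhs_nbhs (conj od cp)) nb => q cq qr.
by rewrite (gauss_map_chart cq) (gauss_map_chart cp) (nc _ qr).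
Qed.

End in_chart.

(** The preimage by g of any set of values is open, since g is locally constant;
    so the fibres of g are both open and closed. *)
Lemma gauss_map_cst p q : connected [set: S] -> g q = g p.
Proof.
move=> conn.
have og (A : set (option (complex R))) : open (g @^-1` A).
  rewrite openE => a Aa; have [c Mc ca] := atlas_cover M a.
  by have := gauss_map_locally_cst Mc ca; apply: filterS => b; rewrite /= => ->.
have : g @^-1` [set g p] = setT.
  apply: conn; first by exists p.
    by exists (g @^-1` [set g p]); rewrite ?setTI//.
  exists (g @^-1` [set g p]); last by rewrite setTI.
  by rewrite -[X in closed X]setCK; apply: open_closedC; rewrite preimage_setC; exact: og.
by move/seteqP => [_ h]; exact: (h q I).
Qed.

(** The vector a is the normal at p0. In any other chart the normal is also a, as
    both have the same stereographic projection. *)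
Lemma image_in_cylinder (p0 : S) : connected [set: S] ->
  exists2 a : 'rV[R]_3, a != 0 & forall p, dot a (sval (X p).1) = 0.
Proof.
move=> conn; have [c0 Mc0 cp0] := atlas_cover M p0.
have imm c (Mc : atlas M c) z (Uz : cimg c z) :
    dot (euclid_normal c X z) (euclid_normal c X z) = 1.
  have [h _] := immX; have [sx ix] := h c Mc.
  exact: euclid_normal1.
have U0 : cimg c0 (cmap c0 p0) by exists p0.
have a1 := imm c0 Mc0 _ U0; exists (euclid_normal c0 X (cmap c0 p0)).
  by apply/eqP => a0; move: a1; rewrite a0 dot0l => /esym/eqP; rewrite oner_eq0.
move=> p; have [c Mc cp] := atlas_cover M p.
have Up : cimg c (cmap c p) by exists p.
have ss : stereo (euclid_normal c0 X (cmap c0 p0)) = stereo (euclid_normal c X (cmap c p)).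
  apply: (etrans (esym (gauss_map_chart Mc0 cp0))).
  exact: (etrans (gauss_map_cst p p0 conn) (gauss_map_chart Mc cp)).
rewrite (stereo_inj a1 (imm c Mc _ Up) ss).
have [_ _ cK _ _] := atlas_chart Mc.
have xp : local_rep c X (cmap c p) = expR (X p).2 *: sval (X p).1.
  by rewrite /local_rep /comp (cK p cp).
have := normal_orth Mc Up; rewrite xp dotC dotZr => h.
by apply: (mulfI (lt0r_neq0 (expR_gt0 (X p).2))); rewrite mulr0.
Qed.

End singular_minimal_surface.

Theorem proposition4p12 (R : realType) (Sigma : topologicalType)
    (M : oriented_riemannian_surface R Sigma)
    (X : Sigma -> S2xR R) (g : Sigma -> option (complex R)) :
  connected [set: Sigma] ->
  conformal_immersion M X ->
  minimal M X ->
  is_gauss_map M X g ->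
  singular_map M g ->
  (exists gamma : set (sphere2 R),
     great_circle gamma /\ range X `<=` vertical_cylinder gamma) /\
  (exists w : option (complex R), forall p, g p = w).
Proof.
move=> conn immX minX gX sing.
have [[p0 _]|noS] := pselect (exists p : Sigma, True); last first.
  split; last by exists None => p; case: noS; exists p.
  exists [set y | dot (evec R 0) (sval y) = 0]; split.
    exists (evec R 0) => //; apply/eqP => /rowP/(_ 0).
    by rewrite !mxE eqxx => /eqP; rewrite oner_eq0.
  by move=> q [p _ _]; case: noS; exists p.
split; last first.
  by exists (g p0) => p; exact: (gauss_map_cst immX minX gX sing p0 p conn).
have [a a0 aX] := image_in_cylinder immX minX gX sing p0 conn.
exists [set y | dot a (sval y) = 0]; split; first by exists a.
by move=> _ [p _ <-]; exact: aX.
Qed.
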